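(* The random critical $2$-SAT problem, i.e. the random $2$-SAT problem with clause density $\alpha=1$ (so that $\Phi\sim F_2(n,n)$), has $f_\star(n)=n^{1/3}$ degrees of freedom weakly.
   Context: Notation. $[n]=\{1,\dots,n\}$, $\pm[n]=\{-n,\dots,-1,1,\dots,n\}$, $\mathbb{B}=\{\texttt{true},\texttt{false}\}$. A literal $\ell\in\pm[n]$ is identified with the map $\mathbb{B}^n\to\mathbb{B}$ given by $x\mapsto x_{\ell}$ if $\ell>0$ and $x\mapsto\neg x_{|\ell|}$ if $\ell<0$. A $k$-SAT formula with $n$ variables and $m$ clauses is an ordered conjunction $\varphi=\bigwedge_{j=1}^m(\ell_{j,1}\vee\dots\vee\ell_{j,k})$ with each $(\ell_{j,1},\dots,\ell_{j,k})\in\mathcal{D}=\{(\ell_1,\dots,\ell_k)\in(\pm[n])^k:|\ell_1|<\dots<|\ell_k|\}$, regarded also as a function $\mathbb{B}^n\to\mathbb{B}$. A function $g:\mathbb{B}^n\to\mathbb{B}$ is satisfiable, written $g\in\mathrm{SAT}$, if $g(x)=\texttt{true}$ for some $x\in\mathbb{B}^n$. $F_k(n,m)$ is the law of the random formula whose $m$ clauses are independent and uniformly distributed on $\mathcal{D}$. Fixing variables. A set $\mathcal{L}\subseteq\pm[n]$ is consistent if $\ell\in\mathcal{L}$ implies $-\ell\notin\mathcal{L}$. For consistent $\mathcal{L}$ and $x\in\mathbb{B}^n$, $x_{\mathcal{L}}\in\mathbb{B}^n$ has $(x_{\mathcal{L}})_v=\texttt{true}$ if $v\in\mathcal{L}$,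 $(x_{\mathcal{L}})_v=\texttt{false}$ if $-v\in\mathcal{L}$, and $(x_{\mathcal{L}})_v=x_v$ otherwise. Put $\Phi_{\mathcal{L}}(x)=\Phi(x_{\mathcal{L}})$. Definition (weak degrees of freedom). The random $k$-SAT problem with clause density $\alpha>0$ has $f_\star(n)$ degrees of freedom weakly if, for $\Phi\sim F_k(n,\lfloor\alpha n\rfloor)$, for every (non-random, $n$-dependent) consistent $\mathcal{L}=\mathcal{L}_n\subseteq\pm[n]$ with $|\mathcal{L}|=f(n)$, and for all $\varepsilon>0$: (1) whenever $f=O(f_\star n^{-\varepsilon})$, then $\liminf_{n\to\infty}\mathbb{P}(\Phi_{\mathcal{L}}\in\mathrm{SAT})=\liminf_{n\to\infty}\mathbb{P}(\Phi\in\mathrm{SAT})>0$; (2) whenever $f=\Omega(f_\star n^{\varepsilon})$, then $\lim_{n\to\infty}\mathbb{P}(\Phi_{\mathcal{L}}\in\mathrm{SAT})=0$. *)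

(* Defs.v *)
From mathcomp Require Import all_boot all_order all_algebra.
From mathcomp Require Import all_classical all_reals all_analysis.

Set Implicit Arguments.
Unset Strict Implicit.
Unset Printing Implicit Defensive.

Import Order.TTheory GRing.Theory Num.Theory.
Import numFieldNormedType.Exports.

Local Open Scope classical_set_scope.
Local Open Scope ring_scope.

(* The variables [n] are 'I_n, and the literals ±[n] are pairs (v, s) of a
   variable and a sign: (v, true) is the positive literal v and (v, false)
   is its negation. *)
Definition literal (n : nat) : finType := ('I_n * bool)%type.

Definition lit_var (n : nat) (l : literal n) : 'I_n := l.1.

Definition lit_neg (n : nat) (l : literal n) : literal n := (l.1, ~~ l.2).

Definition assignment (n : nat) : finType := {ffun 'I_n -> bool}.

Definition lit_eval (n : nat) (l : literal n) (x : assignment n) : bool :=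
  if l.2 then x (lit_var l) else ~~ x (lit_var l).

(* The set D of k-tuples of literals with |l_1| < ... < |l_k|. *)
Definition clause (k n : nat) : finType :=
  {c : k.-tuple (literal n) | sorted ltn [seq val (lit_var l) | l <- c]}.

Definition clause_eval (k n : nat) (c : clause k n) (x : assignment n) : bool :=
  [exists i : 'I_k, lit_eval (tnth (val c) i) x].

Definition formula (k n m : nat) : finType := {ffun 'I_m -> clause k n}.

Definition formula_eval (k n m : nat) (phi : formula k n m)
    (x : assignment n) : bool :=
  [forall j : 'I_m, clause_eval (phi j) x].

Definition satisfiable (n : nat) (g : assignment n -> bool) : bool :=
  [exists x : assignment n, g x].

Definition consistent (n : nat) (L : {set literal n}) : Prop :=
  forall l : literal n, l \in L -> lit_neg l \notin L.

Definition fix_assignment (n : nat) (L : {set literal n})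
    (x : assignment n) : assignment n :=
  [ffun v => if (v, true) \in L then true
             else if (v, false) \in L then false
             else x v].

Definition fix_vars (n : nat) (L : {set literal n})
    (g : assignment n -> bool) : assignment n -> bool :=
  fun x => g (fix_assignment L x).

(* Point masses of the uniform law on D.  When n < k the set D is empty and
   F_k(n, m) makes no sense for m > 0; there is then no formula and every
   [formula_prob] is 0, which is irrelevant as n tends to infinity. *)
Definition clause_law (R : realType) (k n : nat) (c : clause k n) : R :=
  (#|clause k n|%:R)^-1.

(* Point masses of F_k(n, m): independence of the clauses is expressed by the
   product of their laws. *)
Definition formula_law (R : realType) (k n m : nat) (phi : formula k n m) : R :=
  \prod_(j < m) clause_law R (phi j).

Definition formula_prob (R : realType) (k n m : nat)
    (E : pred (formula k n m)) : R :=
  \sum_(phi : formula k n m | E phi) formula_law R phi.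

Definition num_clauses (R : realType) (alpha : R) (n : nat) : nat :=
  Num.truncn (alpha * n%:R).

Definition sat_prob (R : realType) (k : nat) (alpha : R) (n : nat) : R :=
  formula_prob R
    (fun phi : formula k n (num_clauses alpha n) =>
       satisfiable (formula_eval phi)).

Definition sat_prob_fixed (R : realType) (k : nat) (alpha : R) (n : nat)
    (L : {set literal n}) : R :=
  formula_prob R
    (fun phi : formula k n (num_clauses alpha n) =>
       satisfiable (fix_vars L (formula_eval phi))).

(* For alpha > 0: the random k-SAT problem with clause density alpha has fstar
   degrees of freedom weakly.  The inferior limits are taken in \bar R. *)
Definition weak_degrees_of_freedom (R : realType) (k : nat) (alpha : R)
    (fstar : nat -> R) : Prop :=
  forall (f : nat -> nat) (L : forall n : nat, {set literal n}),
    (forall n, consistent (L n)) ->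
    (forall n, #|L n| = f n) ->
  forall eps : R, 0 < eps ->
    (((fun n => (f n)%:R : R^o) =O_\oo
        (fun n => fstar n * n%:R `^ (- eps) : R^o)) ->
       limn_einf (fun n => (sat_prob_fixed k alpha (L n))%:E)
         = limn_einf (fun n => (sat_prob k alpha n)%:E)
       /\ (0 < limn_einf (fun n => (sat_prob k alpha n)%:E))%E)
    /\
    (((fun n => (f n)%:R : R^o) =Omega_\oo
        (fun n => fstar n * n%:R `^ eps : R^o)) ->
       sat_prob_fixed k alpha (L n) @[n --> \oo] --> (0 : R)).

(* Main.v *)
Require Import Defs.
From mathcomp Require Import all_classical all_reals all_analysis.
From mathcomp Require Import all_boot all_order all_fingroup all_algebra.
From mathcomp Require Import ring lra.

(** Fixing a consistent set [L] of [f] literals destroys satisfiability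
only if unit propagation from [L] meets a conflict. Propagation keeps a queue of
literals that are true but not yet processed. Processing one of them removes it,
and the clauses containing its negation force new literals: at clause density one,
with [n] variables, about one literal in the mean. So the length of the queue is
nearly a critical random walk. While [a] literals are waiting, a step meets a
conflict, a clause made of the negations of two of them, with probability about
[a / 2n]. A walk started well below [n ^ (1/3)] dies out while the conflict
probabilities still add up to a small number. A walk started well above
[n ^ (1/3)] stays near [f] for [n ^ (2/3)] steps, and there the conflict
probabilities add up to [f / n ^ (1/3)], up to a constant, which is large.

This is made precise when every possible clause is present independently with
probability [p]. Then processing a literal reveals only clauses that are
independent of the rest, and [step_lower] and [step_upper] bound the probability
for a queue of length [a] by a binomial mean of the probabilities for the next
length. Each of the three estimates needed is an induction on the number of
variables with an explicit function of [a].
- [autarky_lower]: no conflict occurs from a short queue, with the test function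
  [(1 - z) ^+ a]. Then fixing [L] keeps the formula satisfiable if it was so
  ([autarky_sat_with]).
- [sat_with_upper]: from a long queue, satisfiability is unlikely. The test
  function is the squared deviation of the queue from its initial length, plus the
  probability that no conflict occurs while the queue is long.
- [sat_with_window]: the formula is satisfiable with probability bounded below.
  The process runs from a single literal, with a new one whenever the queue is
  empty, and the test function is the exponential of minus a quadratic polynomial in [a].
  After order [n ^ (2/3)] steps the remaining formula is subcritical, and by a
  first moment computation it contains no bicycle, a necessary cycle of
  implications for unsatisfiability, with probability at least one half
  ([sat_with_empty_lower]).

A formula of the statement consists instead of [n] independent uniform clauses.
Satisfiability and success of the propagation can only be lost when clauses are
added, and averaged over all relabelings of the clauses they depend only on the
number of distinct clauses. A shift of [p] by order [n ^ (- 4/3)] moves this number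
beyond its fluctuations but stays inside the critical window, so the two models
bound each other ([drawn_ge], [drawn_le]). *)

Set Implicit Arguments.
Unset Strict Implicit.
Unset Printing Implicit Defensive.

Import Order.TTheory GRing.Theory Num.Theory.
Import numFieldNormedType.Exports.

Local Open Scope ring_scope.

(** * Independent Bernoulli inclusions and binomial means *)

Section Bernoulli.
Context {R : realFieldType} {I : finType} (p : R).
Implicit Types (s : seq I) (f g : {set I} -> R) (S : {set I}).

(** The elements of [s] are revealed one at a time, each being present with
probability [p]. A list rather than a set of elements lets an exploration choose
the order of revelation. *)
Fixpoint bernE s f : R :=
  if s is c :: s' then
    (1 - p) * bernE s' f + p * bernE s' (fun S => f (c |: S))
  else f set0.

Lemma eq_bernE s f g : f =1 g -> bernE s f = bernE s g.
Proof. by elim: s f g => [|c s IHs] f g fg //=; congr (_ * _ + _ * _); apply: IHs. Qed.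

Lemma bernE_cst s (x : R) : bernE s (fun=> x) = x.
Proof. by elim: s => [|c s IHs] //=; rewrite IHs; ring. Qed.

Lemma bernE_linear s f g (x y : R) :
  bernE s (fun S => x * f S + y * g S) = x * bernE s f + y * bernE s g.
Proof. by elim: s f g => [|c s IHs] f g //=; rewrite !IHs; ring. Qed.

Lemma bernED s f g : bernE s (fun S => f S + g S) = bernE s f + bernE s g.
Proof.
have /= := bernE_linear s f g 1 1; rewrite !mul1r => <-.
by apply: eq_bernE => S; rewrite !mul1r.
Qed.

Lemma bernEZ s f (x : R) : bernE s (fun S => x * f S) = x * bernE s f.
Proof.
have /= := bernE_linear s f f x 0; rewrite mul0r addr0 => <-.
by apply: eq_bernE => S; rewrite mul0r addr0.
Qed.

Lemma bernE_sum s (J : Type) (r : seq J) (P : pred J) (F : J -> {set I} -> R) :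
  bernE s (fun S => \sum_(j <- r | P j) F j S) = \sum_(j <- r | P j) bernE s (F j).
Proof.
elim: r => [|j r IHr].
  rewrite big_nil -[RHS](bernE_cst s); apply: eq_bernE => S.
  by rewrite big_nil.
rewrite big_cons -IHr; case Pj: (P j); last first.
  by apply: eq_bernE => S; rewrite big_cons Pj.
by rewrite -bernED; apply: eq_bernE => S; rewrite big_cons Pj.
Qed.

Lemma bernE_cat s1 s2 f :
  bernE (s1 ++ s2) f = bernE s1 (fun S1 => bernE s2 (fun S2 => f (S1 :|: S2))).
Proof.
elim: s1 f => [|c s1 IHs] f /=.
  by apply: eq_bernE => S; rewrite set0U.
rewrite !IHs; congr (_ * _ + _ * _).
by apply: eq_bernE => S1; apply: eq_bernE => S2; rewrite setUA.
Qed.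

Lemma bernE_exchange s1 s2 (F : {set I} -> {set I} -> R) :
  bernE s1 (fun S1 => bernE s2 (F S1)) =
  bernE s2 (fun S2 => bernE s1 (F^~ S2)).
Proof.
elim: s1 F => [|c s1 IHs] F //=.
by rewrite bernE_linear -!IHs.
Qed.

(** Independence: an exploration may reveal first the elements that it needs. *)
Lemma bernE_perm s1 s2 f : perm_eq s1 s2 -> bernE s1 f = bernE s2 f.
Proof.
move: s1 s2; apply: catCA_perm_subst => s1 s2 s3.
rewrite !catA !(bernE_cat (_ ++ _)) !bernE_cat [RHS]bernE_exchange.
apply: eq_bernE => S1; apply: eq_bernE => S2; apply: eq_bernE => S3.
by rewrite (setUC S2).
Qed.

Hypothesis p01 : 0 <= p <= 1.

Lemma bernE_le s f g :
  (forall S, S \subset s -> f S <= g S) -> bernE s f <= bernE s g.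
Proof.
have /andP[p0 p1] := p01.
elim: s f g => [|c s IHs] f g fg /=; first by apply: fg; apply/subsetP => x; rewrite inE.
rewrite lerD// ler_wpM2l ?subr_ge0//.
  by apply: IHs => S sS; apply: fg; apply/subsetP => x /(subsetP sS); rewrite inE orbC => ->.
apply: IHs => S sS; apply: fg; apply/subsetP => x.
by rewrite !inE => /orP[->//|/(subsetP sS) ->]; rewrite orbT.
Qed.

Lemma bernE_ge_cst s f x :
  (forall S, S \subset s -> x <= f S) -> x <= bernE s f.
Proof. by move=> xf; rewrite -[x in x <= _](bernE_cst s); exact: bernE_le. Qed.

Lemma bernE_le_cst s f x :
  (forall S, S \subset s -> f S <= x) -> bernE s f <= x.
Proof. by move=> xf; rewrite -[x in _ <= x](bernE_cst s); exact: bernE_le. Qed.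

(** The outcome in which nothing is present already has weight [(1-p)^|s|]. *)
Lemma bernE_ge_set0 s f :
  (forall S, 0 <= f S) -> (1 - p) ^+ size s * f set0 <= bernE s f.
Proof.
have /andP[p0 p1] := p01.
elim: s f => [|c s IHs] f f0 /=; first by rewrite expr0 mul1r.
rewrite exprS -mulrA -[leLHS]addr0 lerD//.
  by rewrite ler_wpM2l ?subr_ge0// IHs.
by rewrite mulr_ge0// bernE_ge_cst.
Qed.

Lemma bernE_eq_set0 s f :
  (forall S, S != set0 -> f S = 0) -> bernE s f = (1 - p) ^+ size s * f set0.
Proof.
elim: s f => [|c s IHs] f f0 /=; first by rewrite expr0 mul1r.
rewrite IHs// [X in p * X](_ : _ = 0) ?mulr0 ?addr0 ?exprS ?mulrA//.
rewrite (@eq_bernE _ _ (fun=> 0)) ?bernE_cst// => S.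
by rewrite f0//; apply/set0Pn; exists c; rewrite !inE eqxx.
Qed.

(** An equality when [Q] is contained in [s]; otherwise the left-hand side is [0]. *)
Lemma bernE_all_present s (Q : seq I) : uniq s -> uniq Q ->
  bernE s (fun S => (all (mem S) Q)%:R) <= p ^+ size Q.
Proof.
have /andP[p0 p1] := p01.
elim: s Q => [|c s IHs] Q.
  move=> _ _ /=; case: Q => [|c Q] /=; rewrite ?expr0// inE /=.
  by rewrite exprn_ge0.
move=> /= /andP[cs us] uQ; case: (boolP (c \in Q)) => cQ; last first.
  rewrite (@eq_bernE s (fun S => (all _ Q)%:R) (fun S => (all (mem S) Q)%:R)); last first.
    move=> S; congr (_%:R); congr nat_of_bool; apply: eq_in_all => x xQ.
    by rewrite !inE; case: eqP => // xc; rewrite -xc xQ in cQ.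
  rewrite -mulrDl subrK mul1r; exact: IHs.
have -> : bernE s (fun S => (all (mem S) Q)%:R) = 0.
  apply/eqP; rewrite eq_le; apply/andP; split; last by apply: bernE_ge_cst.
  apply: bernE_le_cst => S Ss; case: allP => // /(_ _ cQ) /=.
  by move=> /(subsetP Ss); rewrite (negPf cs).
rewrite mulr0 add0r (perm_size (perm_to_rem cQ)) /= exprS ler_wpM2l//.
rewrite (@eq_bernE s _ (fun S => (all (mem S) (rem c Q))%:R)); last first.
  move=> S; congr (_%:R); congr nat_of_bool; rewrite (perm_all _ (perm_to_rem cQ)) /=.
  rewrite !inE eqxx /=; apply: eq_in_all => x xQ; rewrite !inE.
  by case: eqP => // xc; move: xQ; rewrite xc mem_rem_uniqF.
by apply: IHs; rewrite ?rem_uniq.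
Qed.
End Bernoulli.

Lemma bernE_map (R : realFieldType) (I J : finType) (p : R) (h : I -> J)
    (s : seq I) (f : {set J} -> R) :
  bernE p (map h s) f = bernE p s (fun S => f [set h x | x in S]).
Proof.
elim: s f => [|c s IHs] f /=; first by rewrite imset0.
rewrite !IHs; congr (_ + _ * _).
by apply: eq_bernE => S; rewrite imsetU1.
Qed.

Section Binomial.
Context {R : realFieldType} (r : R).
Implicit Types (psi : nat -> R) (k b : nat).

(** [binE k b psi] is the mean of [psi (b + Z)], [Z] binomial with parameters
[k] and [r]. *)
Fixpoint binE k b psi : R :=
  if k is k'.+1 then (1 - r) * binE k' b psi + r * binE k' b.+1 psi else psi b.

Lemma eq_binE k b psi1 psi2 : psi1 =1 psi2 -> binE k b psi1 = binE k b psi2.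
Proof. by move=> e; elim: k b => [|k IHk] b //=; rewrite !IHk. Qed.

Lemma binE_linear k b psi1 psi2 (x y : R) :
  binE k b (fun a => x * psi1 a + y * psi2 a)
  = x * binE k b psi1 + y * binE k b psi2.
Proof. by elim: k b => [|k IHk] b //=; rewrite !IHk; ring. Qed.

Lemma binE_quad k b (x y z : R) :
  binE k b (fun a => x + y * a%:R + z * a%:R ^+ 2) =
  x + y * (b%:R + k%:R * r)
    + z * ((b%:R + k%:R * r) ^+ 2 + k%:R * r * (1 - r)).
Proof.
elim: k b => [|k IHk] b /=; first by rewrite !mul0r addr0 addr0.
by rewrite !IHk -!natr1; ring.
Qed.

Lemma binE_cst k b (x : R) : binE k b (fun=> x) = x.
Proof. by elim: k b => [|k IHk] b //=; rewrite !IHk; ring. Qed.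

Lemma binE_geom k b (x : R) :
  binE k b (fun a => x ^+ a) = x ^+ b * (1 - r + r * x) ^+ k.
Proof.
elim: k b => [|k IHk] b /=; first by rewrite expr0 mulr1.
by rewrite !IHk !exprS; ring.
Qed.

Hypothesis r01 : 0 <= r <= 1.

Lemma binE_le k b psi1 psi2 :
  (forall a, psi1 a <= psi2 a) -> binE k b psi1 <= binE k b psi2.
Proof.
have /andP[r0 r1] := r01; move=> le12.
by elim: k b => [|k IHk] b //=; rewrite lerD// ler_wpM2l ?subr_ge0.
Qed.
End Binomial.

Lemma bernE_card (R : realFieldType) (I : finType) (p : R) (s : seq I)
    (psi : nat -> R) :
  uniq s -> bernE p s (fun S => psi #|S|) = binE p (size s) 0 psi.
Proof.
rewrite -[in RHS](cards0 I) => us.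
rewrite (_ : bernE _ _ _ = bernE p s (fun S => psi #|set0 :|: S|)); last first.
  by apply: eq_bernE => S; rewrite set0U.
have : [disjoint [set: I] :&: set0 & s].
  by rewrite setI0 disjoint_subset; apply/subsetP => x; rewrite inE.
rewrite setI0; move: (@set0 I) => T.
elim: s us T => [|c s IHs] /=; first by move=> _ T _; rewrite setU0.
move=> /andP[cs us] T; rewrite disjoint_sym disjoint_cons => /andP[cT].
rewrite disjoint_sym => Ts; rewrite IHs//; congr (_ + _ * _).
have := IHs us (c |: T); rewrite cardsU1 cT add1n => <-; last first.
  rewrite disjoint_subset; apply/subsetP => x; rewrite !inE => /predU1P[->//|xT].
  by have := disjointFr Ts xT => ->.
by apply: eq_bernE => S; rewrite setUCA setUA.
Qed.

Lemma bernE_card_variance (R : realFieldType) (I : finType) (p : R) (s : seq I) :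
  uniq s ->
  bernE p s (fun S => (#|S|%:R - (size s)%:R * p) ^+ 2)
  = (size s)%:R * p * (1 - p).
Proof.
move=> us; have := bernE_card p (fun a => (a%:R - (size s)%:R * p) ^+ 2) us.
move=> /= ->; set m := (size s)%:R * p.
rewrite (@eq_binE _ _ _ _ _ (fun a => m ^+ 2 + (- 2 * m) * a%:R + 1 * a%:R ^+ 2)).
  by rewrite binE_quad add0r -/m; ring.
by move=> a; ring.
Qed.

(** * Clauses on a set of variables, satisfiability, autarkies *)

Lemma lit_negK n : involutive (@lit_neg n).
Proof. by case=> v s; rewrite /lit_neg /= negbK. Qed.

Lemma lit_neg_neq n (l : literal n) : (lit_neg l == l) = false.
Proof. by case: l => v [] /=; apply/eqP => -[]. Qed.

Lemma lit_eval_neg n (l : literal n) x : lit_eval (lit_neg l) x = ~~ lit_eval l x.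
Proof. by case: l => v [] //=; rewrite /lit_eval /= negbK. Qed.

Lemma lit_var_eq n (l k : literal n) : l.1 = k.1 -> l = k \/ l = lit_neg k.
Proof.
by case: l k => [v s] [w t] /= ->; rewrite /lit_neg /=; case: s t => [] []; auto.
Qed.

Section Formulas.
Context {n : nat}.
Implicit Types (V : {set 'I_n}) (A B T Y : {set literal n}) (l x y z : literal n).
Implicit Types (c : {set literal n}) (S : {set {set literal n}}).

Definition lits V : {set literal n} := [set l | l.1 \in V].

(** Clauses are unordered pairs here: unlike a sorted tuple, such a pair can be
written down from two literals without comparing their variables. *)
Definition clauses_on V : {set {set literal n}} :=
  [set c | [exists a : literal n, exists b : literal n,
    [&& a.1 \in V, b.1 \in V, a.1 != b.1 & c == [set a; b]]]].

Lemma clauses_onP V c : reflect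
  (exists a b : literal n, [/\ a.1 \in V, b.1 \in V, a.1 != b.1 & c = [set a; b]])
  (c \in clauses_on V).
Proof.
rewrite inE; apply: (iffP existsP) => [[a /existsP[b /and4P[aV bV ab /eqP ->]]]|].
  by exists a, b.
by move=> [a [b [aV bV ab ->]]]; exists a; apply/existsP; exists b; rewrite aV bV ab eqxx.
Qed.

Lemma mem_clauses_on V l k :
  ([set l; k] \in clauses_on V) = [&& l.1 \in V, k.1 \in V & l.1 != k.1].
Proof.
apply/clauses_onP/and3P => [[a [b [aV bV ab e]]]|[? ? ?]]; last by exists l, k.
have la : l \in [set a; b] by rewrite -e set21.
have ka : k \in [set a; b] by rewrite -e set22.
have bl : b \in [set l; k] by rewrite e set22.
have al : a \in [set l; k] by rewrite e set21.
have neq : l != k.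
  apply: contraNneq ab => lk; move: al bl; rewrite lk !inE !orbb.
  by move=> /eqP -> /eqP ->.
move: la ka; rewrite !inE => /orP[]/eqP la /orP[]/eqP ka; rewrite la ka ?eqxx// in neq *.
by rewrite eq_sym.
Qed.

Lemma clauses_onE V c l : c \in clauses_on V -> l \in c ->
  exists k, [/\ c = [set l; k], l.1 \in V, k.1 \in V & l.1 != k.1].
Proof.
case/clauses_onP => a [b [aV bV ab ->]]; rewrite !inE => /orP[] /eqP ->.
  by exists b.
by exists a; split=> //; [exact: setUC|rewrite eq_sym].
Qed.

Lemma clauses_onS V (W : {set 'I_n}) : V \subset W -> clauses_on V \subset clauses_on W.
Proof.
move=> VW; apply/subsetP => c /clauses_onP[a [b [aV bV ab ->]]].
by rewrite mem_clauses_on !(subsetP VW).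
Qed.

Definition consistentb A := [forall l in A, lit_neg l \notin A].

Lemma consistentbP A : reflect (consistent A) (consistentb A).
Proof. by apply: (iffP forall_inP). Qed.

(** For consistent [A], requiring its literals to be true is the same as fixing
them. *)
Definition sat_with A S := [exists x : assignment n,
  [forall l in A, lit_eval l x] && [forall c in S, [exists l in c, lit_eval l x]]].

Lemma sat_withP A S : reflect
  (exists x : assignment n, {in A, forall l, lit_eval l x} /\
             {in S, forall c, exists2 l, l \in c & lit_eval l x})
  (sat_with A S).
Proof.
apply: (iffP existsP) => -[x].
  move=> /andP[/forall_inP xA /forall_inP xS]; exists x; split=> // c cS.
  exact/exists_inP/xS.
move=> [xA xS]; exists x; apply/andP; split; apply/forall_inP => //.
by move=> c /xS ?; apply/exists_inP.
Qed.

(** [T] is an autarky: a partial assignment that satisfies every clause which it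
touches. Unit propagation from [A] produces one unless it meets a conflict. *)
Definition autarky A S := [exists T : {set literal n}, [&& consistentb T, A \subset T &
  [forall c in S, [exists l in c, lit_neg l \in T] ==> [exists l in c, l \in T]]]].

Lemma autarkyP A S : reflect
  (exists T, [/\ consistent T, A \subset T &
     forall c l, c \in S -> l \in c -> lit_neg l \in T -> exists2 k, k \in c & k \in T])
  (autarky A S).
Proof.
apply: (iffP existsP) => -[T].
  move=> /and3P[/consistentbP cT AT /forall_inP TS]; exists T; split=> // c l cS lc lT.
  by have /implyP/(_ _)/exists_inP := TS c cS; apply; apply/exists_inP; exists l.
move=> [cT AT TS]; exists T; rewrite AT (introT (consistentbP _) cT) /=.
apply/forall_inP => c cS; apply/implyP => /exists_inP[l lc lT].
by apply/exists_inP; exact: TS lc lT.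
Qed.

Lemma sat_withS A B S S' : A \subset B -> S \subset S' -> sat_with B S' -> sat_with A S.
Proof.
move=> AB SS' /sat_withP[x [xB xS']]; apply/sat_withP; exists x; split=> [l lA|c cS].
  exact/xB/(subsetP AB).
exact/xS'/(subsetP SS').
Qed.

Lemma autarkyS A B S S' : A \subset B -> S \subset S' -> autarky B S' -> autarky A S.
Proof.
move=> AB SS' /autarkyP[T [cT BT TS]]; apply/autarkyP; exists T; split=> //.
  exact: fintype.subset_trans BT.
by move=> c l /(subsetP SS'); exact: TS.
Qed.

(** A satisfying assignment may be overridden by an autarky [T]: the clauses that
lose a true literal are touched by [T], hence satisfied by it. *)
Lemma autarky_sat_with A S : autarky A S -> sat_with set0 S -> sat_with A S.
Proof.
move=> /autarkyP[T [cT AT TS]] /sat_withP[x [_ xS]]; apply/sat_withP.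
pose y : assignment n :=
  [ffun v => if (v, true) \in T then true else if (v, false) \in T then false else x v].
have yT l : l \in T -> lit_eval l y.
  case: l => v [] lT; rewrite /lit_eval /= ffunE lT//=.
  by have := cT _ lT; rewrite /lit_neg /= => /negPf ->.
have yx l : lit_neg l \notin T -> lit_eval l x -> lit_eval l y.
  case: l => v [] /=; rewrite /lit_neg /lit_eval /= ffunE.
    by move=> /negPf ->; case: ifP.
  by move=> /negPf ->; case: ifP.
exists y; split=> [l /(subsetP AT)/yT//|c cS].
have [l lc lx] := xS _ cS; case: (boolP (lit_neg l \in T)) => lT; last first.
  by exists l => //; exact: yx.
by have [k kc kT] := TS _ _ cS lc lT; exists k => //; exact: yT.
Qed.

(** One step of unit propagation, which sets [x] to true: each clause containing
the negation of [x] has to supply a literal of [B], the clauses containing [x]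
disappear, and [B] remains to be treated in the clauses without the variable of
[x]. *)
Definition propagates (Ev : {set literal n} -> {set {set literal n}} -> bool) :=
  forall V x B S, x.1 \in V -> B \subset lits (V :\ x.1) -> S \subset clauses_on V ->
    (forall c, c \in S -> lit_neg x \in c -> exists2 y, y \in c & y \in B) ->
    Ev B (S :&: clauses_on (V :\ x.1)) -> Ev (x |: B) S.

Lemma clauses_on_cases V x c : c \in clauses_on V ->
  [\/ x \in c, lit_neg x \in c | c \in clauses_on (V :\ x.1)].
Proof.
case/clauses_onP => a [b [aV bV ab ->]].
case: (eqVneq a.1 x.1) => [/lit_var_eq[->|->]|ax].
- by constructor 1; rewrite set21.
- by constructor 2; rewrite set21.
case: (eqVneq b.1 x.1) => [/lit_var_eq[->|->]|bx].
- by constructor 1; rewrite set22.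
- by constructor 2; rewrite set22.
by constructor 3; rewrite mem_clauses_on !inE ax bx aV bV ab.
Qed.

Lemma clauses_onD1_var V x c l : c \in clauses_on (V :\ x.1) -> l \in c -> l.1 != x.1.
Proof. by move=> cV lc; have [k [_]] := clauses_onE cV lc; rewrite !inE => /andP[]. Qed.

Lemma sat_with_propagates : propagates sat_with.
Proof.
move=> V x B S xV BV SV Sx /sat_withP[s [sB sS]]; apply/sat_withP.
pose t : assignment n := [ffun v => if v == x.1 then x.2 else s v].
have tx : lit_eval x t by rewrite /lit_eval /= ffunE eqxx; case: (x.2).
have ts l : l.1 != x.1 -> lit_eval l t = lit_eval l s.
  by move=> /negPf lx; rewrite /lit_eval /lit_var /= ffunE lx.
have tB l : l \in B -> lit_eval l t.
  move=> lB; rewrite ts ?sB//; have := subsetP BV _ lB.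
  by rewrite !inE => /andP[].
exists t; split=> [l /setU1P[->//|]|c cS]; first exact: tB.
case: (clauses_on_cases x (subsetP SV _ cS)) => [xc|xc|cV].
- by exists x.
- by have [y yc yB] := Sx _ cS xc; exists y => //; exact: tB.
have [l lc ls] : exists2 l, l \in c & lit_eval l s by apply: sS; rewrite inE cS.
by exists l => //; rewrite ts// (clauses_onD1_var cV lc).
Qed.

Lemma autarky_propagates : propagates autarky.
Proof.
move=> V x B S xV BV SV Sx /autarkyP[T [cT BT TS]]; apply/autarkyP.
pose T' := T :&: lits (V :\ x.1).
have T'x l : l \in T' -> l.1 != x.1 by rewrite !inE => /and3P[].
have T'B : B \subset T' by rewrite subsetI BT.
exists (x |: T'); split.
- move=> l /setU1P[->|lT]; rewrite in_setU1 negb_or.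
    rewrite lit_neg_neq /=; apply/negP => /T'x.
    by rewrite /lit_neg /= eqxx.
  apply/andP; split; last by move: lT; rewrite !inE => /andP[lT _]; rewrite (negPf (cT _ lT)).
  by apply/eqP => e; have := T'x l lT; rewrite -e /= eqxx.
- exact: finset.setUS.
move=> c l cS lc.
case: (clauses_on_cases x (subsetP SV _ cS)) => [xc|xc|cV] lT.
- by exists x; rewrite // setU11.
- have [y yc yB] := Sx _ cS xc; exists y => //.
  by rewrite inE (subsetP T'B) ?orbT.
have lx := clauses_onD1_var cV lc.
have lT' : lit_neg l \in T.
  case/setU1P: lT => [e|]; last by rewrite inE => /andP[].
  by move: lx; rewrite -e /= eqxx.
have [|k kc kT] := TS c l _ lc lT'; first by rewrite inE cS.
exists k => //; rewrite !inE kT (clauses_onD1_var cV kc) /=.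
by have [? [_ ]] := clauses_onE cV kc; rewrite !inE => /andP[_ ->]; rewrite orbT.
Qed.
End Formulas.

(** * Processing one literal of the queue *)

Section Reveal.
Context {R : realFieldType} {n : nat} (p : R).
Implicit Types (V : {set 'I_n}) (A B T Y : {set literal n}) (l x y z : literal n).
Implicit Types (c : {set literal n}) (S D : {set {set literal n}}).

Lemma bernE_setD (I : finType) (D1 D : {set I}) f : D1 \subset D ->
  bernE p (enum D) f =
  bernE p (enum D1) (fun E1 => bernE p (enum (D :\: D1)) (fun E2 => f (E1 :|: E2))).
Proof.
move=> /fintype.subsetP D1D; rewrite -bernE_cat; apply: bernE_perm.
apply: uniq_perm; rewrite ?enum_uniq// ?cat_uniq ?enum_uniq/= ?andbT.
  by apply/hasPn => x; rewrite !mem_enum inE => /andP[].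
move=> x; rewrite mem_cat !mem_enum inE.
by case: (boolP (x \in D1)) => // /D1D.
Qed.

(** The two literals of a variable are adjacent, so that they are revealed
together. *)
Definition signed (vs : seq 'I_n) : seq (literal n) :=
  flatten [seq [:: (v, true); (v, false)] | v <- vs].

Lemma mem_signed vs l : (l \in signed vs) = (l.1 \in vs).
Proof.
case: l => v s; apply/flatten_mapP/idP => /= [[w wvs]|vvs].
  by rewrite !inE => /orP[]/eqP[-> _].
by exists v; rewrite // !inE; case: s; rewrite eqxx ?orbT.
Qed.

Lemma signed_uniq vs : uniq vs -> uniq (signed vs).
Proof.
elim: vs => [|v vs IH] //= /andP[vvs uvs].
rewrite -/(signed vs) IH// inE !mem_signed /= (negPf vvs) orbF !andbT.
by apply/eqP => -[].
Qed.

Lemma consistentb0 : consistentb (set0 : {set literal n}).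
Proof. by apply/consistentbP => l; rewrite inE. Qed.

(** Two present literals of the same variable are a conflict, avoided with
probability [1 - p ^+ 2]; given that, exactly one of them is present with
probability [2 * p / (1 + p)]. *)
Lemma bernE_signed (vs : seq 'I_n) b psi : p != -1 -> uniq vs ->
  bernE p (signed vs) (fun Y => if consistentb Y then psi (b + #|Y|)%N else 0)
  = (1 - p ^+ 2) ^+ size vs * binE (2 * p / (1 + p)) (size vs) b psi.
Proof.
move=> p1.
have p1' : 1 + p != 0 by rewrite addrC; apply: contraNneq p1 => /eqP; rewrite addr_eq0.
pose F Y0 Y := if consistentb (Y0 :|: Y) then psi (b + #|Y0 :|: Y|)%N else 0.
suff H Y0 : consistentb Y0 -> uniq vs ->
    (forall l, l \in Y0 -> l.1 \notin vs) ->
    bernE p (signed vs) (F Y0) =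
    (1 - p ^+ 2) ^+ size vs * binE (2 * p / (1 + p)) (size vs) (b + #|Y0|)%N psi.
  move=> uvs; have := H _ consistentb0 uvs; rewrite cards0 addn0 => <-.
    by apply: eq_bernE => Y; rewrite /F set0U.
  by move=> l; rewrite inE.
elim: vs Y0 => [|v vs IH] Y0 cY uvs Yvs.
  by rewrite /= expr0 mul1r /F setU0 cY.
move: uvs => /= /andP[vvs uvs].
have Yvs' l : l \in Y0 -> l.1 \notin vs.
  by move=> /Yvs; rewrite inE negb_or => /andP[].
have Yv l : l \in Y0 -> l.1 != v.
  by move=> /Yvs; rewrite inE negb_or => /andP[].
have one s : bernE p (signed vs) (fun Y => F Y0 ((v, s) |: Y)) =
    (1 - p ^+ 2) ^+ size vs *
    binE (2 * p / (1 + p)) (size vs) (b + #|Y0|).+1 psi.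
  have vY : (v, s) \notin Y0 by apply/negP => /Yv; rewrite eqxx.
  have -> : (b + #|Y0|).+1 = (b + #|(v, s) |: Y0|)%N.
    by rewrite cardsU1 vY addnCA.
  rewrite -IH//.
  - by apply: eq_bernE => Y; rewrite /F setUCA setUA.
  - apply/consistentbP => l /setU1P[->|lY]; rewrite in_setU1 negb_or.
      rewrite lit_neg_neq /=; apply/negP => /Yv.
      by rewrite /lit_neg /= eqxx.
    rewrite (forall_inP cY _ lY) andbT.
    by apply/eqP => e; have := Yv _ lY; rewrite -[l.1]/((lit_neg l).1) e eqxx.
  - by move=> l /setU1P[->//|/Yvs'].
have both : bernE p (signed vs) (fun Y => F Y0 ((v, true) |: ((v, false) |: Y))) = 0.
  rewrite -[RHS](bernE_cst p (signed vs)); apply: eq_bernE => Y; rewrite /F.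
  case: ifP => // /consistentbP/(_ (v, true)); rewrite !inE eqxx orbT => /(_ isT).
  by rewrite /lit_neg /= eqxx !orbT.
have none : bernE p (signed vs) (F Y0) = (1 - p ^+ 2) ^+ size vs *
    binE (2 * p / (1 + p)) (size vs) (b + #|Y0|)%N psi by exact: IH.
rewrite /= !one both none (exprS _ (size vs)).
set x := binE _ _ _ _; set y := binE _ _ _ _; set e := (1 - p ^+ 2) ^+ _.
by field.
Qed.

Variables (V : {set 'I_n}) (A : {set literal n}) (x : literal n).
Hypotheses (xA : x \in A) (AV : A \subset lits V) (cA : consistent A).
Let V' := V :\ x.1.
Let A' := A :\ x.
(* The variables that are not yet determined. *)
Let F := [set v in V | [forall l in A, l.1 != v]].
(* The clauses that would contradict a literal waiting in [A]. *)
Let K := [set [set lit_neg x; lit_neg z] | z in A'].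
(* The clauses that would force an undetermined variable. *)
Let U := [set [set lit_neg x; y] | y in lits F].
(* The other clauses with the variable of [x]: they contain [x] or a literal of
   [A], and are satisfied. *)
Let W := ((clauses_on V :\: K) :\: U) :\: clauses_on V'.

Let xV : x.1 \in V.
Proof. by have := fintype.subsetP AV x xA; rewrite inE. Qed.

Let A'x l : l \in A' -> l.1 != x.1.
Proof.
rewrite !inE => /andP[lx lA]; apply/eqP => /lit_var_eq[/eqP|e]; first by rewrite (negPf lx).
by have := cA xA; rewrite -e lA.
Qed.

Let Fx v : v \in F -> v != x.1.
Proof. by rewrite inE => /andP[_ /forall_inP/(_ _ xA)]; rewrite eq_sym. Qed.

Let FV v : v \in F -> v \in V.
Proof. by rewrite inE => /andP[]. Qed.

Let A'V l : l \in A' -> l.1 \in V'.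
Proof.
move=> lA'; rewrite !inE A'x//=.
by have := fintype.subsetP AV l; rewrite inE; apply; move: lA'; rewrite inE => /andP[].
Qed.

Let KV : K \subset clauses_on V.
Proof.
apply/fintype.subsetP => c /imsetP[z zA ->]; rewrite mem_clauses_on /= xV.
by have := A'V zA; rewrite !inE => /andP[zx ->]; rewrite eq_sym.
Qed.

Let negx_notin c : c \in clauses_on V' -> lit_neg x \in c -> False.
Proof. by move=> cV /(clauses_onD1_var cV) /=; rewrite eqxx. Qed.

Let UV : U \subset clauses_on V :\: K.
Proof.
apply/fintype.subsetP => c /imsetP[y]; rewrite inE => yF ->.
rewrite inE mem_clauses_on /= xV FV//= eq_sym Fx// andbT.
apply/negP => /imsetP[z zA e].
have : y \in [set lit_neg x; lit_neg z] by rewrite -e set22.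
rewrite !inE => /orP[]/eqP yx; first by have := Fx yF; rewrite yx /= eqxx.
move: yF; rewrite inE => /andP[_ /forall_inP/(_ z)]; rewrite yx /= eqxx.
by move: zA; rewrite inE => /andP[_ zA] /(_ zA).
Qed.

Let V'D : clauses_on V' \subset (clauses_on V :\: K) :\: U.
Proof.
apply/fintype.subsetP => c cV'; rewrite !in_setD.
rewrite (fintype.subsetP (clauses_onS (subD1set V x.1)) _ cV') andbT.
by apply/andP; split; apply/negP => /imsetP[z _ e];
  apply: (negx_notin cV'); rewrite e set21.
Qed.

Lemma reveal f :
  bernE p (enum (clauses_on V)) f =
  bernE p (enum K) (fun S0 => bernE p (signed (enum F)) (fun Y =>
    bernE p (enum W) (fun S3 => bernE p (enum (clauses_on V')) (fun S2 =>
      f (S0 :|: ([set [set lit_neg x; y] | y in Y] :|: (S3 :|: S2))))))).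
Proof.
rewrite (bernE_setD _ KV); apply: eq_bernE => S0.
rewrite (bernE_setD _ UV).
rewrite (@bernE_perm _ _ _ _ [seq [set lit_neg x; y] | y <- signed (enum F)]).
  rewrite bernE_map; apply: eq_bernE => Y.
  rewrite (bernE_setD _ V'D) bernE_exchange; apply: eq_bernE => S3.
  by apply: eq_bernE => S2; rewrite (setUC S2).
apply: uniq_perm; first exact: enum_uniq.
  rewrite map_inj_in_uniq ?signed_uniq ?enum_uniq// => y z.
  rewrite !mem_signed !mem_enum => yF zF e.
  have : y \in [set lit_neg x; z] by rewrite -e set22.
  rewrite !inE => /orP[]/eqP // yx.
  by have := Fx yF; rewrite yx /= eqxx.
move=> c; rewrite mem_enum; apply/imsetP/mapP => -[y yF ->]; exists y => //.
  by rewrite mem_signed mem_enum; rewrite in_set in yF.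
by rewrite in_set -mem_enum -mem_signed.
Qed.

Let cardK : size (enum K) = #|A|.-1.
Proof.
rewrite -cardE card_in_imset ?(cardsD1 x A) ?xA// => y z yA zA e.
have : lit_neg y \in [set lit_neg x; lit_neg z] by rewrite -e set22.
rewrite !inE => /orP[]/eqP/(can_inj (@lit_negK n)) // yx.
by have := A'x yA; rewrite yx eqxx.
Qed.

Let cardA' : #|A'| = #|A|.-1.
Proof. by rewrite (cardsD1 x A) xA. Qed.

Let cardF : (#|V| - #|A| <= #|F| <= #|V|)%N.
Proof.
apply/andP; split; last by apply/subset_leq_card/fintype.subsetP => v /FV.
rewrite leq_subLR; have /subset_leq_card : V \subset [set l.1 | l in A] :|: F.
  apply/fintype.subsetP => v vV; rewrite inE.
  case: (boolP (v \in [set l.1 | l in A])) => //= /imsetP vA; rewrite inE vV /=.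
  by apply/forall_inP => l lA; apply/eqP => lv; apply: vA; exists l.
move=> /leq_trans; apply; apply: leq_trans (leq_card_setU _ _) _.
by rewrite leq_add2r leq_imset_card.
Qed.

Let subY Y : Y \subset signed (enum F) -> Y \subset lits F.
Proof.
move=> /fintype.subsetP H; apply/fintype.subsetP => l /H.
by rewrite mem_signed mem_enum [_ \in lits _]in_set.
Qed.

Let disjAY Y : Y \subset lits F -> #|A' :|: Y| = (#|A|.-1 + #|Y|)%N.
Proof.
move=> /fintype.subsetP YF; rewrite cardsU cardA'.
rewrite (_ : A' :&: Y = set0) ?cards0 ?subn0//; apply/setP => l; rewrite !inE.
apply/negP => /andP[/andP[_ lA] /YF]; rewrite !inE => /andP[_ /forall_inP/(_ l lA)].
by rewrite eqxx.
Qed.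

Let validAY Y : Y \subset lits F -> consistent Y ->
  A' :|: Y \subset lits V' /\ consistent (A' :|: Y).
Proof.
move=> /fintype.subsetP YF cY; split.
  apply/fintype.subsetP => l /setUP[/A'V|/YF]; first by rewrite [_ \in lits _]in_set.
  by rewrite [_ \in lits _]in_set => lF; rewrite in_set in_setD1 Fx// FV.
have AY l : l \in A' -> lit_neg l \notin Y.
  move=> lA; apply/negP => /YF; rewrite !inE => /andP[_ /forall_inP/(_ l)].
  by rewrite /= eqxx; move: lA; rewrite inE => /andP[_ lA] /(_ lA).
move=> l /setUP[lA|lY]; rewrite inE negb_or.
  rewrite AY// andbT; move: lA; rewrite !inE negb_and => /andP[_ lA].
  by rewrite cA// orbT.
by rewrite cY// andbT; apply/negP => /AY; rewrite lit_negK lY.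
Qed.

Let WA c : c \in W -> lit_neg x \in c -> forall B, A' \subset B ->
  exists2 y, y \in c & y \in B.
Proof.
rewrite !in_setD => /and4P[_ cU cK cV] /(clauses_onE cV)[k [ck _ kV kx]] B AB.
suff kA : k \in A' by exists k; rewrite ?(fintype.subsetP AB)// ck set22.
have : k.1 \notin F.
  by apply: contra cU => kF; apply/imsetP; exists k; rewrite // inE.
rewrite inE kV /= negb_forall => /existsP[l]; rewrite negb_imply negbK => /andP[lA /eqP lk].
have lA' : l \in A'.
  by rewrite !inE lA andbT; apply: contraNneq kx => lx; rewrite -lk lx.
case: (lit_var_eq lk) => [<-//|e].
by case/imsetP: cK; exists l => //; rewrite e lit_negK.
Qed.

Hypothesis p01 : 0 <= p < 1.
Let p01' : 0 <= p <= 1.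
Proof. by case/andP: p01 => -> /ltW ->. Qed.
Let pN1 : p != -1.
Proof. by apply: contraTneq p01 => ->; rewrite oppr_ge0 ler10. Qed.

(** Processing [x] reveals only the clauses with the variable of [x], and the
others stay independent of what is seen. If no clause of [K] is present and the
clauses of [U] force a consistent set [Y], then [A :\ x :|: Y] is waiting on
[V :\ x.1]. *)
Lemma step_lower Ev psi :
  propagates Ev ->
  (forall B1 B2 S, B1 \subset B2 -> Ev B2 S -> Ev B1 S) ->
  (forall B, B \subset lits V' -> consistent B ->
     psi #|B| <= bernE p (enum (clauses_on V')) (fun S => (Ev B S)%:R)) ->
  exists2 u, (#|V| - #|A| <= u <= #|V|)%N &
    (1 - p) ^+ #|A|.-1 * ((1 - p ^+ 2) ^+ u * binE (2 * p / (1 + p)) u #|A|.-1 psi)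
    <= bernE p (enum (clauses_on V)) (fun S => (Ev A S)%:R).
Proof.
move=> propEv monEv IH; exists #|F|; first exact: cardF.
rewrite reveal.
apply: le_trans (bernE_ge_set0 p01' _ _); last by move=> S; do 3! (apply: bernE_ge_cst => // ? _).
rewrite cardK ler_wpM2l ?exprn_ge0 ?subr_ge0//; first by case/andP: p01'.
rewrite cardE -bernE_signed ?enum_uniq//; apply: bernE_le => // Y /subY YF.
case: (boolP (consistentb Y)) => [/consistentbP cY|_]; last first.
  by do 2! (apply: bernE_ge_cst => // ? _).
apply: bernE_ge_cst => // S3 S3W.
have [BV' cB] := validAY YF cY.
rewrite -disjAY//; apply: le_trans (IH _ BV' cB) _.
apply: bernE_le => // S2 S2V'; rewrite set0U ler_nat.
case Ev2 : (Ev _ _) => //; rewrite lt0b.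
set S := (_ :|: _).
have S2V c : c \in S2 -> c \in clauses_on V' by move=> /(fintype.subsetP S2V'); rewrite mem_enum.
have S3V c : c \in S3 -> c \in W by move=> /(fintype.subsetP S3W); rewrite mem_enum.
have eA : A \subset x |: (A' :|: Y) by rewrite setUA setD1K// subsetUl.
apply: (monEv _ _ _ eA); apply: (propEv V) => //.
- apply/fintype.subsetP => c /setUP[/imsetP[y /(fintype.subsetP YF)]|/setUP[/S3V|/S2V]].
  + move=> yF ->; have := fintype.subsetP UV [set lit_neg x; y].
    rewrite in_setD => /(_ _)/andP[|_ //].
    by apply/imsetP; exists y.
  + by rewrite !in_setD => /and4P[].
  + by move=> /(fintype.subsetP (clauses_onS (subD1set V x.1))).
- move=> c /setUP[/imsetP[y yY ->] _|/setUP[/S3V/WA H /H H'|/S2V/negx_notin H /H//]].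
    by exists y; rewrite ?set22// inE yY orbT.
  by apply: H'; exact: subsetUl.
- rewrite (_ : S :&: _ = S2)//; apply/setP => c; rewrite in_setI !in_setU.
  apply/idP/idP => [/andP[/orP[/imsetP[y yY ->]|/orP[/S3V|//]]]|cS2].
  + by move=> /negx_notin; rewrite set21 => /(_ isT).
  + by rewrite in_setD => /andP[/negPf ->].
  + by rewrite cS2 !orbT S2V.
Qed.

(** The converse for satisfiability: an assignment making [A] true excludes the
clauses of [K] and makes the forced literals true. *)
Lemma step_upper psi :
  (forall B, B \subset lits V' -> consistent B ->
     bernE p (enum (clauses_on V')) (fun S => (sat_with B S)%:R) <= psi #|B|) ->
  exists2 u, (#|V| - #|A| <= u <= #|V|)%N &
    bernE p (enum (clauses_on V)) (fun S => (sat_with A S)%:R)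
    <= (1 - p) ^+ #|A|.-1 * ((1 - p ^+ 2) ^+ u * binE (2 * p / (1 + p)) u #|A|.-1 psi).
Proof.
move=> IH; exists #|F|; first exact: cardF.
rewrite reveal -cardK.
have forced S (s : assignment n) y : {in A, forall l, lit_eval l s} ->
    {in S, forall c, exists2 l, l \in c & lit_eval l s} ->
    [set lit_neg x; y] \in S -> lit_eval y s.
  move=> sA sS /sS[l]; rewrite !inE => /orP[]/eqP -> //.
  by rewrite lit_eval_neg sA.
set G := (fun S0 => _).
pose G0 S0 := (S0 == set0)%:R * G set0.
apply: (@le_trans _ _ (bernE p (enum K) G0)).
  apply: bernE_le => // S0 S0K; rewrite /G0; case: eqP => [->|/eqP/set0Pn[c cS0]].
    by rewrite mul1r.
  have /imsetP[z zA cE] : c \in K by rewrite -mem_enum (fintype.subsetP S0K).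
  rewrite mul0r; do 3! (apply: bernE_le_cst => // ? _).
  rewrite lern0 eqb0; apply/negP => /sat_withP[s [sA sS]].
  have zs : lit_eval (lit_neg z) s.
    by apply: forced sA sS _; rewrite -cE inE cS0.
  by move: zs; rewrite lit_eval_neg sA//; move: zA; rewrite inE => /andP[].
rewrite bernE_eq_set0 ?/G0 ?eqxx ?mul1r; last by move=> S0 /negPf ->; rewrite mul0r.
rewrite ler_wpM2l ?exprn_ge0 ?subr_ge0//; first by case/andP: p01'.
rewrite cardE -bernE_signed ?enum_uniq//; apply: bernE_le => // Y /subY YF.
case: (boolP (consistentb Y)) => [/consistentbP cY|]; last first.
  rewrite negb_forall => /existsP[l]; rewrite negb_imply negbK => /andP[lY nlY].
  do 2! (apply: bernE_le_cst => // ? _).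
  rewrite lern0 eqb0; apply/negP => /sat_withP[s [sA sS]].
  have ls y : y \in Y -> lit_eval y s.
    by move=> yY; apply: forced sA sS _; rewrite !inE; apply/orP; right;
      apply/orP; left; apply/imsetP; exists y.
  by have := ls _ nlY; rewrite lit_eval_neg ls.
apply: bernE_le_cst => // S3 _.
have [BV' cB] := validAY YF cY.
rewrite cardK -disjAY//; apply: le_trans (IH _ BV' cB).
apply: bernE_le => // S2 _; rewrite ler_nat.
case sE : (sat_with A _) => //; rewrite lt0b; move/sat_withP: sE => -[s [sA sS]].
apply/sat_withP; exists s; split=> [l /setUP[|lY]|c cS2].
- by rewrite inE => /andP[_ /sA].
- by apply: forced sA sS _; rewrite !inE; apply/orP; right;
      apply/orP; left; apply/imsetP; exists l.
- by apply: sS; rewrite !inE cS2 !orbT.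
Qed.
End Reveal.

(** * Short queues: propagation without a conflict *)

Section Elementary.
Context {R : realFieldType}.
Implicit Types (p x : R).

Lemma pow1B_ge x k : 0 <= x <= 1 -> 1 - k%:R * x <= (1 - x) ^+ k.
Proof.
move=> /andP[x0 x1]; elim: k => [|k IHk]; first by rewrite mul0r subr0 expr0.
rewrite exprS; apply: le_trans (ler_wpM2l _ IHk); last by rewrite subr_ge0.
rewrite -natr1; have : 0 <= k%:R :> R by []; nra.
Qed.

(** The upper bound [(1 + k x)^-1] for [(1 - x) ^+ k], without a division. *)
Lemma pow1B_mul_le1 x k : 0 <= x <= 1 -> (1 - x) ^+ k * (1 + k%:R * x) <= 1.
Proof.
move=> /andP[x0 x1]; elim: k => [|k IHk]; first by rewrite mul0r expr0 addr0 mulr1.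
have q0 : 0 <= (1 - x) ^+ k by rewrite exprn_ge0 ?subr_ge0.
rewrite exprS -natr1; apply: le_trans IHk; rewrite mulrAC mulrC.
rewrite ler_wpM2l//; have : 0 <= k%:R :> R by []; nra.
Qed.

(** Processing a literal while [a] are waiting meets a conflict in two ways: with
one of the [a - 1] other waiting literals, or at one of [u] undetermined variables
whose two literals are both forced. The second way costs no more than one further
waiting literal. *)
Lemma no_conflict_weight p a u : 0 <= p <= 1 -> (0 < a)%N -> u%:R * p <= 1 ->
  1 - a%:R * p <= (1 - p) ^+ a.-1 * (1 - p ^+ 2) ^+ u <= 1.
Proof.
move=> p01 a0 up; have /andP[p0 p1] := p01.
have p201 : 0 <= p ^+ 2 <= 1 by rewrite sqr_ge0 expr_le1.
have := pow1B_ge a.-1 p01; have := pow1B_ge u p201.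
have q1 : 0 <= (1 - p) ^+ a.-1 <= 1.
  by rewrite exprn_ge0 ?subr_ge0// exprn_ile1 ?subr_ge0// gerBl.
have q2 : 0 <= (1 - p ^+ 2) ^+ u <= 1.
  have /andP[? ?] := p201; by rewrite exprn_ge0 ?subr_ge0// exprn_ile1 ?subr_ge0// gerBl.
have -> : a%:R = a.-1%:R + 1 :> R by rewrite natr1 prednK.
move: q1 q2.
set X := _ ^+ a.-1; set Y := _ ^+ u; move=> /andP[X0 X1] /andP[Y0 Y1] hY hX.
apply/andP; split; last by apply: mulr_ile1.
have : (1 - X) * (1 - Y) >= 0 by rewrite mulr_ge0 ?subr_ge0.
have : p * (u%:R * p) <= p * 1 by rewrite ler_wpM2l.
by move: hX hY; rewrite expr2; lra.
Qed.

(** Bounds for the probability that a variable is forced. *)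
Lemma binE_rate p : 0 <= p <= 1 ->
  [/\ 0 <= 2 * p / (1 + p), 2 * p / (1 + p) <= 2 * p,
      2 * p / (1 + p) <= 1 & 2 * p * (1 - p) <= 2 * p / (1 + p)].
Proof.
move=> /andP[p0 p1]; have q0 : 0 < 1 + p by lra.
split.
- by rewrite divr_ge0 ?mulr_ge0// ltW.
- by rewrite ler_pdivrMr//; nra.
- by rewrite ler_pdivrMr//; lra.
- by rewrite ler_pdivlMr//; nra.
Qed.
End Elementary.

Section Autarky.
Context {R : realFieldType} {n : nat} (p z : R).
Hypotheses (p01 : 0 <= p < 1) (z0 : 0 < z) (z1 : z <= 1 / 2).
Hypothesis pn : 2 * (n.+1%:R * p) <= 1 + z / 8.

Let p01' : 0 <= p <= 1.
Proof. by case/andP: p01 => -> /ltW ->. Qed.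

(** The queue loses one literal and gains about one in the mean, and [(1 - z) ^+ a]
is convex in its length [a]: this gain, of order [z ^+ 2], exceeds the conflict
probability. The second order is obtained by splitting the power into two halves
and applying the Bernoulli inequality to each, since
[(1 - z / 2) ^+ 2 = 1 - z + z ^+ 2 / 4]. *)
Lemma critical_growth (a u : nat) : (u <= n)%N -> a%:R * p <= z ^+ 2 / 8 ->
  1 - z <= (1 - a%:R * p) * (1 - 2 * p / (1 + p) * z) ^+ u.
Proof.
move=> un ap; have /andP[p0 p1] := p01'.
move: (z0) (z1) (pn) => z0' z1' pn'.
have [r0 r2p r1 _] := binE_rate p01'.
set r := 2 * p / (1 + p) in r0 r2p r1 *.
pose m := (uphalf n).
have m2 : 2 * m%:R <= n.+1%:R :> R.
  rewrite -natrM ler_nat /m mul2n; have := odd_double_half n.+1.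
  by rewrite -uphalfE => <-; rewrite leq_addl.
have nm : (n <= m + m)%N.
  rewrite addnn /m; case: (boolP (odd n)) => o; first by rewrite odd_uphalfK.
  by rewrite uphalf_half (negPf o) add0n even_halfK.
have z11 : z <= 1 by lra.
have rz : 0 <= r * z <= 1.
  by rewrite mulr_ge0 ?(ltW z0)//= mulr_ile1 ?(ltW z0).
have le1 : (1 - r * z) ^+ (m + m) <= (1 - r * z) ^+ u.
  apply: ler_wiXn2l; last exact: leq_trans un nm.
    by have /andP[] := rz; lra.
  by have /andP[] := rz; lra.
have le2 : (1 - m%:R * (r * z)) <= (1 - r * z) ^+ m by exact: pow1B_ge.
have mr : m%:R * r <= 1 / 2 + z / 16.
  apply: le_trans (_ : m%:R * (2 * p) <= _); first by rewrite ler_wpM2l.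
  have : (2 * m%:R) * p <= n.+1%:R * p by rewrite ler_wpM2r.
  by lra.
have mr0 : 0 <= m%:R * r by rewrite mulr_ge0.
set w := m%:R * r in mr mr0.
have le3 : 1 - z + z ^+ 2 / 8 <= (1 - r * z) ^+ (m + m).
  have wz : (1 / 2 + z / 16) * z <= 1 by nra.
  have wz' : w * z <= (1 / 2 + z / 16) * z by rewrite ler_wpM2r// ltW.
  rewrite exprD -expr2; apply: le_trans (_ : (1 - w * z) ^+ 2 <= _); last first.
    have lX : 1 - w * z <= (1 - r * z) ^+ m by rewrite /w -mulrA.
    have l0 : 0 <= 1 - w * z by lra.
    by apply: lerXn2r => //; rewrite nnegrE// (le_trans l0).
  apply: le_trans (_ : (1 - (1 / 2 + z / 16) * z) ^+ 2 <= _).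
    have : 0 <= z ^+ 3 by rewrite exprn_ge0 ?ltW.
    have : 0 <= z ^+ 4 by rewrite exprn_ge0 ?ltW.
    rewrite (_ : (1 - _) ^+ 2 = 1 - z + z ^+ 2 / 8 + z ^+ 3 / 16 + z ^+ 4 / 256); last by field.
    lra.
  by apply: lerXn2r; rewrite ?nnegrE; lra.
apply: le_trans (_ : (1 - z ^+ 2 / 8) * (1 - z + z ^+ 2 / 8) <= _).
  by have : 0 <= z ^+ 2 * (z - z ^+ 2 / 8); [rewrite mulr_ge0 ?sqr_ge0// subr_ge0; nra|nra].
have := le_trans le3 le1; set X := _ ^+ u => hX.
apply: ler_pM => //; nra.
Qed.

(** The test function is [(1 - z) ^+ a], which is [1] for an empty queue and, by
[critical_growth], does not exceed its mean after one step as long as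
[a * p <= z ^+ 2 / 8]. For longer queues it is at most [8 * p / z ^+ 3], and
subtracting this constant makes the bound trivial there. *)
Lemma autarky_lower (V : {set 'I_n}) (A : {set literal n}) :
  A \subset lits V -> consistent A ->
  (1 - z) ^+ #|A| - 8 * p / z ^+ 3
    <= bernE p (enum (clauses_on V)) (fun S => (autarky A S)%:R).
Proof.
have [k] := ubnP #|V|; elim: k V A => // k IHk V A Vk AV cA.
move: (z0) (z1) (pn) => z0' z1' pn'.
have /andP[p0 p1] := p01'.
have z3 : 0 < z ^+ 3 by rewrite exprn_gt0.
have e0 : 0 <= 8 * p / z ^+ 3 by rewrite divr_ge0 ?mulr_ge0// ltW.
have [A0|[x xA]] := set_0Vmem A.
  rewrite A0 cards0 expr0; apply: bernE_ge_cst => // S _.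
  rewrite (introT (autarkyP _ _)) ?gerBl//.
  by exists set0; split=> // [l|c l _ _]; rewrite inE.
have a0 : (0 < #|A|)%N by apply/card_gt0P; exists x.
have [small|big] := leP (#|A|%:R * p) (z ^+ 2 / 8); last first.
  apply: (@le_trans _ _ 0); last by apply: bernE_ge_cst.
  rewrite subr_le0.
  have z01 : 0 <= z <= 1 by lra.
  have := pow1B_mul_le1 #|A| z01; have : 0 <= (1 - z) ^+ #|A| by rewrite exprn_ge0; lra.
  set X := _ ^+ _ => X0 hX; rewrite ler_pdivlMr//.
  have a0' : 0 < #|A|%:R :> R by rewrite ltr0n.
  have : X * (#|A|%:R * z) <= 1 by nra.
  have : z ^+ 2 <= 8 * (#|A|%:R * p) by lra.
  rewrite !exprS expr0 mulr1 => h1 h2.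
  have : X * (z * (z * z)) * #|A|%:R <= (8 * p) * #|A|%:R.
    have -> : X * (z * (z * z)) * #|A|%:R = (z * z) * (X * (#|A|%:R * z)) by ring.
    apply: le_trans (_ : (z * z) * 1 <= _); first by rewrite ler_wpM2l// mulr_ge0 ?ltW.
    by rewrite mulr1; lra.
  by rewrite ler_pM2r.
have V'k : (#|V :\ x.1| < k)%N.
  have xV : x.1 \in V by have := fintype.subsetP AV _ xA; rewrite inE.
  by move: Vk; rewrite (cardsD1 x.1 V) xV.
have [] := @step_lower _ _ _ V A x xA AV cA p01 autarky
    (fun a => (1 - z) ^+ a - 8 * p / z ^+ 3) autarky_propagates.
- by move=> B1 B2 S B12; exact: autarkyS.
- by move=> B BV cB; exact: IHk.
move=> u /andP[_ uV]; apply: le_trans.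
have un : (u <= n)%N by apply: leq_trans uV _; rewrite -[leqRHS](card_ord n) max_card.
have up : u%:R * p <= 1.
  apply: le_trans (_ : n.+1%:R * p <= 1); last lra.
  by rewrite ler_wpM2r// ler_nat ltnW.
rewrite mulrA.
have /andP[w1 w2] := no_conflict_weight p01' a0 up.
have /andP[_ wp] : 0 <= (1 - #|A|%:R * p) <= (1 - p) ^+ #|A|.-1 * (1 - p ^+ 2) ^+ u.
  by rewrite w1 andbT; nra.
set e := 8 * p / _ in e0 *; set r := 2 * p / (1 + p).
rewrite (@eq_binE _ r _ _ _ (fun a => 1 * (1 - z) ^+ a + (- e) * 1)); last by move=> a; ring.
rewrite (binE_linear _ _ _ _ (fun=> 1)) binE_cst binE_geom.
rewrite (_ : 1 - r + r * (1 - z) = 1 - r * z); last by ring.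
have := critical_growth un small; rewrite -/r.
have z00 : 0 <= (1 - z) ^+ #|A|.-1 by rewrite exprn_ge0; lra.
rewrite -{2}(prednK a0) exprS.
set w := (1 - p) ^+ _ * _ in wp w1 w2 *; set X := _ ^+ u; set q := (1 - z) ^+ _ in z00 *.
move=> h; have X0 : 0 <= X.
  rewrite exprn_ge0// subr_ge0; have [? ? ? _] := binE_rate p01'.
  by rewrite mulr_ile1 ?(ltW z0)//; lra.
have h' : (1 - z) * q <= (w * X) * q.
  by rewrite ler_wpM2r//; apply: le_trans h _; rewrite ler_wpM2r.
have : w * e <= 1 * e by rewrite ler_wpM2r.
rewrite mul1r => we.
by rewrite [leRHS](_ : _ = (w * X) * q - w * e); [lra|ring].
Qed.
End Autarky.

(** * Long queues: unsatisfiability *)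

Lemma card_set_ord n (V : {set 'I_n}) : (#|V| <= n)%N.
Proof. by rewrite -[leqRHS](card_ord n) max_card. Qed.

Lemma pow1B_le_expR (R : realType) (x : R) k :
  0 <= x <= 1 -> (1 - x) ^+ k <= expR (- (k%:R * x)).
Proof.
move=> /andP[x0 x1]; rewrite -mulrN mulrC expRM_natr.
by apply: lerXn2r; rewrite ?nnegrE ?subr_ge0 ?expR_ge0// expR_ge1Dx.
Qed.

(** One step from queue length [a]: with [s] and [t] the mean and the variance of
the number of forced literals, the left-hand side is the mean squared deviation
from [f] of the new length. *)
Lemma queue_deviation (R : realFieldType) (a f d s t : R) :
  - f <= 2 * (a - f) -> 2 * (a - f) <= f -> d <= 1 -> 1 - d <= s -> s <= 1 ->
  t <= 1 -> (a - 1 + s - f) ^+ 2 + t <= (a - f) ^+ 2 + f * d + 2.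
Proof.
move=> yL yU d1 ds s1 t1; have -> : a - 1 + s - f = (a - f) - (1 - s) by ring.
have e0 : 0 <= 1 - s by lra.
have e1 : 1 - s <= d by lra.
move: (1 - s) e0 e1 => e e0 e1; move: (a - f) yL yU => y yL yU; clear a s ds s1.
have f0 : 0 <= f by lra.
have h1 : - (2 * y) * e <= f * e by rewrite ler_wpM2r//; lra.
have h2 : f * e <= f * d by rewrite ler_wpM2l.
have h3 : e * e <= 1 * 1 by apply: ler_pM => //; lra.
by rewrite !expr2; lra.
Qed.

(** Satisfiability with a queue of about [f] literals needs one of two unlikely
events before the number of variables has dropped to [vend]. Either the queue
leaves the range from [f / 2] to [3 / 2 * f]: its squared deviation from [f]
grows by at most [f * d + 2] per step, [d] bounding the negative drift. Or all
steps avoid a conflict, each with probability at most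
[expR (- (p * (f / 2 - 1)))]. Both terms are trivially large enough at the end,
when [q <= 1]. *)
Lemma sat_with_upper (R : realType) n (p f d vend : R) :
  0 <= p < 1 -> 2 * (n%:R * p) <= 1 -> 2 <= f -> 0 <= d <= 1 ->
  (forall u : nat, vend - 3 / 2 * f <= u%:R -> 1 - d <= u%:R * (2 * p / (1 + p))) ->
  forall (V : {set 'I_n}) (A : {set literal n}),
  A \subset lits V -> consistent A ->
  let q := #|V|%:R - vend + 1 in 0 < q ->
  bernE p (enum (clauses_on V)) (fun S => (sat_with A S)%:R) <=
  4 / f ^+ 2 * ((#|A|%:R - f) ^+ 2 + (f * d + 2) * q)
  + expR (- (p * (f / 2 - 1) * (q - 1))).
Proof.
move=> p01 pn f2 /andP[d0 d1] ur V A.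
have p01' : 0 <= p <= 1 by case/andP: p01 => -> /ltW ->.
have /andP[p0 p1] := p01'.
have [r0 r2p r1 _] := binE_rate p01'.
set r := 2 * p / (1 + p) in ur r0 r2p r1.
have f20 : 0 < 4 / f ^+ 2 by rewrite divr_gt0// exprn_gt0//; lra.
have fd0 : 0 <= f * d by rewrite mulr_ge0//; lra.
have [k] := ubnP #|V|; elim: k V A => // k IHk V A Vk AV cA q q0.
have le1 : bernE p (enum (clauses_on V)) (fun S => (sat_with A S)%:R) <= 1.
  by apply: bernE_le_cst => // S _; rewrite -[leRHS]/(1%:R) ler_nat leq_b1.
have t1 : 0 <= 4 / f ^+ 2 * ((#|A|%:R - f) ^+ 2 + (f * d + 2) * q).
  rewrite mulr_ge0// ?(ltW f20)// addr_ge0// ?sqr_ge0// mulr_ge0// ?(ltW q0)//; lra.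
have pf : 0 <= p * (f / 2 - 1) by rewrite mulr_ge0//; lra.
have [q1|q1] := leP q 1.
  apply: le_trans le1 _; apply: le_trans (_ : 0 + 1 <= _); first by rewrite add0r.
  rewrite lerD//; apply: le_trans (expR_ge1Dx _).
  have : 0 <= p * (f / 2 - 1) * (1 - q) by rewrite mulr_ge0// subr_ge0.
  lra.
have [far|near] := leP (f ^+ 2) (4 * (#|A|%:R - f) ^+ 2).
  apply: le_trans le1 _; apply: le_trans (_ : 1 + 0 <= _); first by rewrite addr0.
  rewrite lerD// ?expR_ge0// mulrDr.
  apply: le_trans (_ : 1 + 0 <= _); first by rewrite addr0.
  rewrite lerD//; last first.
    by rewrite mulr_ge0// ?(ltW f20)// mulr_ge0// ?(ltW q0)//; lra.
  by rewrite mulrAC ler_pdivlMr ?mul1r// exprn_gt0//; lra.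
have aL : f / 2 <= #|A|%:R.
  by rewrite leNgt; apply/negP => ?; move: near; rewrite expr2 expr2; nra.
have aU : #|A|%:R <= 3 / 2 * f.
  by rewrite leNgt; apply/negP => ?; move: near; rewrite expr2 expr2; nra.
have a0 : (0 < #|A|)%N by rewrite -(ltr_nat R); lra.
have /card_gt0P[x xA] := a0.
have xV : x.1 \in V by have := fintype.subsetP AV _ xA; rewrite inE.
have V'k : (#|V :\ x.1| < k)%N by move: Vk; rewrite (cardsD1 x.1 V) xV.
have V'q : #|V :\ x.1|%:R - vend + 1 = q - 1.
  by rewrite /q [in RHS](cardsD1 x.1 V) xV add1n -natr1; ring.
pose E := expR (- (p * (f / 2 - 1) * (q - 1 - 1))).
pose psi a := 4 / f ^+ 2 * ((a%:R - f) ^+ 2 + (f * d + 2) * (q - 1)) + E.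
have [B BV cB|u /andP[Vu uV]] := @step_upper _ _ _ V A x xA AV cA p01 psi.
  have := IHk _ B V'k BV cB; rewrite V'q; apply.
  by rewrite subr_gt0.
move=> /le_trans; apply.
have ea : #|A|%:R = #|A|.-1%:R + 1 :> R by rewrite natr1 prednK.
have un : (u <= n)%N by apply: leq_trans uV (card_set_ord V).
have ur1 : u%:R * r <= 1.
  have : u%:R * r <= n%:R * (2 * p) by apply: ler_pM; rewrite // ler_nat.
  by lra.
have ur0 : 1 - d <= u%:R * r.
  apply: ur; have : #|V|%:R <= u%:R + #|A|%:R :> R.
    by rewrite -natrD ler_nat addnC -leq_subLR.
  by rewrite /q in q1; lra.
have up : u%:R * p <= 1.
  apply: le_trans (_ : n%:R * p <= _); first by rewrite ler_wpM2r// ler_nat.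
  by have : 0 <= n%:R * p by [rewrite mulr_ge0]; lra.
have /andP[_ w1] := no_conflict_weight p01' a0 up.
have w2 : (1 - p) ^+ #|A|.-1 * (1 - p ^+ 2) ^+ u <= expR (- (p * (f / 2 - 1))).
  apply: le_trans (_ : (1 - p) ^+ #|A|.-1 * 1 <= _).
    rewrite ler_wpM2l ?exprn_ge0 ?subr_ge0// exprn_ile1//.
      by rewrite subr_ge0 expr_le1.
    by rewrite gerBl sqr_ge0.
  rewrite mulr1; apply: le_trans (pow1B_le_expR _ p01') _.
  by rewrite ler_expR lerN2 (mulrC p) ler_wpM2r//; lra.
rewrite mulrA; have w0 : 0 <= (1 - p) ^+ #|A|.-1 * (1 - p ^+ 2) ^+ u.
  by rewrite mulr_ge0 ?exprn_ge0 ?subr_ge0// expr_le1.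
set w := (1 - p) ^+ _ * _ in w0 w1 w2 *.
have -> : binE r u #|A|.-1 psi = 4 / f ^+ 2 * ((#|A|.-1%:R + u%:R * r - f) ^+ 2
    + u%:R * r * (1 - r) + (f * d + 2) * (q - 1)) + E.
  rewrite (@eq_binE _ r _ _ _ (fun a => (4 / f ^+ 2 * (f ^+ 2 + (f * d + 2) * (q - 1)) + E)
     + (4 / f ^+ 2 * (- (2 * f))) * a%:R + (4 / f ^+ 2) * a%:R ^+ 2)); last first.
    by move=> a; rewrite /psi; ring.
  by rewrite binE_quad; ring.
rewrite mulrDr; apply: lerD; last first.
  have -> : - (p * (f / 2 - 1) * (q - 1)) =
    - (p * (f / 2 - 1)) + - (p * (f / 2 - 1) * (q - 1 - 1)) by ring.
  by rewrite expRD ler_wpM2r// expR_ge0.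
set m := u%:R * r in ur1 ur0 *.
set X := _ + _ + _.
have X0 : 0 <= X.
  rewrite !addr_ge0// ?sqr_ge0//; last by rewrite mulr_ge0//; lra.
  by rewrite mulr_ge0// ?subr_ge0// /m mulr_ge0.
apply: le_trans (_ : 1 * (4 / f ^+ 2 * X) <= _).
  by rewrite ler_wpM2r// mulr_ge0// ltW.
rewrite mul1r ler_pM2l//.
have r1' : 1 - r <= 1 by lra.
have r10 : 0 <= 1 - r by lra.
have m0 : 0 <= m by rewrite /m mulr_ge0.
have := @queue_deviation _ #|A|%:R f d m (m * (1 - r)) _ _ d1 ur0 ur1
  (mulr_ile1 m0 r10 ur1 r1').
have -> : #|A|%:R - 1 + m - f = #|A|.-1%:R + m - f by rewrite ea; ring.
by move=> h; rewrite /X; have := h _ _; lra.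
Qed.

(** * Bicycles and subcritical formulas *)

(** Telescoping: the quadratic polynomial [h] below satisfies
[r ^+ 2 <= h r - x * h (r + 1)], so the sum is at most [h 0]. *)
Lemma sum_sqr_geom (R : realFieldType) (x d : R) N : 0 <= x -> x <= 1 - d -> 0 < d <= 1 ->
  \sum_(r < N) r%:R ^+ 2 * x ^+ r <= 3 / d ^+ 3.
Proof.
move=> x0 xd /andP[d0 d1].
have dn0 : d != 0 by rewrite gt_eqF.
pose h (r : R) := r ^+ 2 / d + 2 * r / d ^+ 2 + 3 / d ^+ 3.
have h0 (r : nat) : 0 <= h r%:R.
  by rewrite /h !addr_ge0// divr_ge0 ?mulr_ge0 ?exprn_ge0// ltW.
suff : \sum_(r < N) r%:R ^+ 2 * x ^+ r <= h 0 - h N%:R * x ^+ N.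
  move=> /le_trans; apply; have : 0 <= h N%:R * x ^+ N by rewrite mulr_ge0 ?exprn_ge0.
  by rewrite /h expr0n mulr0 !mul0r !add0r; lra.
elim: N => [|N IHN]; first by rewrite big_ord0 expr0 mulr1 subrr.
rewrite big_ord_recr /=; apply: le_trans (lerD IHN (lexx _)) _.
rewrite -subr_ge0.
suff : 0 <= (h N%:R - x * h N.+1%:R - N%:R ^+ 2) * x ^+ N.
  by congr (0 <= _); rewrite (exprS x); ring.
suff : 0 <= h N%:R - x * h N.+1%:R - N%:R ^+ 2 by move=> ?; rewrite mulr_ge0 ?exprn_ge0.
rewrite subr_ge0; apply: le_trans (_ : h N%:R - (1 - d) * h N.+1%:R <= _); last first.
  by rewrite lerD2l lerN2 ler_wpM2r.
rewrite -subr_ge0 -natr1; set X := (X in 0 <= X).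
have -> : X = 2 * N%:R + 1 + d^-1 + d^-1 ^+ 2 by rewrite /X /h; field.
by rewrite !addr_ge0 ?mulr_ge0 ?invr_ge0 ?exprn_ge0 ?invr_ge0// ltW.
Qed.

Section Words.
Context {T : eqType}.
Implicit Types (s w : seq T).

Fixpoint words s r : seq (seq T) :=
  if r is r'.+1 then [seq x :: w | x <- s, w <- words s r'] else [:: [::]].

Lemma size_words s r : size (words s r) = (size s ^ r)%N.
Proof. by elim: r => [|r IHr] //=; rewrite size_allpairs IHr expnS. Qed.

Lemma mem_words s w : {subset w <= s} -> w \in words s (size w).
Proof.
elim: w => [|x w IHw] //= ws; apply/allpairsP; exists (x, w); split=> //=.
  by rewrite ws ?mem_head.
by apply: IHw => y yw; rewrite ws// inE yw orbT.
Qed.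

Lemma size_of_words s r w : w \in words s r -> size w = r.
Proof.
elim: r w => [|r IHr] w /=; first by rewrite inE => /eqP ->.
by case/allpairsP => -[x v] /= [_ /IHr <- ->].
Qed.

Lemma first_dup (T' : eqType) (h : T -> T') s : ~~ uniq [seq h x | x <- s] ->
  exists s1 y s2, [/\ s = s1 ++ y :: s2, uniq [seq h x | x <- s1] &
                      h y \in [seq h x | x <- s1]].
Proof.
elim/last_ind: s => [|s y IHs] //; rewrite map_rcons rcons_uniq negb_and negbK.
case: (boolP (uniq [seq h x | x <- s])) => [us|/IHs[s1 [z [s2 [-> us1 zs1]]]] _].
  by rewrite orbF => ys; exists s, y, [::]; rewrite cats1.
by exists s1, z, (rcons s2 y); rewrite rcons_cat.
Qed.
End Words.

Section Bicycle.
Context {n : nat}.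
Implicit Types (V : {set 'I_n}) (T : {set literal n}) (l x y z : literal n) (t : seq (literal n)).
Implicit Types (c : {set literal n}) (S : {set {set literal n}}).

Definition implication x y : {set literal n} := [set lit_neg x; y].
Definition edge S : rel (literal n) := [rel x y | implication x y \in S].

Lemma edge_contra S x y : edge S x y = edge S (lit_neg y) (lit_neg x).
Proof. by rewrite /edge /= /implication lit_negK setUC. Qed.

Lemma connect_contra S x y :
  connect (edge S) x y -> connect (edge S) (lit_neg y) (lit_neg x).
Proof.
case/connectP => t; elim: t x => [|z t IHt] x /= => [_ ->|/andP[xz zt] yt] //.
by apply: connect_trans (IHt _ zt yt) (connect1 _); rewrite -edge_contra.
Qed.

(** A maximal consistent set closed under implication is total, hence a satisfying
assignment, unless some literal and its negation imply each other: otherwise one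
of the two literals of an unassigned variable does not imply its negation, and its
consequences can be added. *)
Lemma unsat_contradictory V S : S \subset clauses_on V -> ~~ sat_with set0 S ->
  exists x, connect (edge S) x (lit_neg x) /\ connect (edge S) (lit_neg x) x.
Proof.
move=> SV; apply: contraNP => noc.
pose P T := consistentb T && [forall a in T, forall b, edge S a b ==> (b \in T)].
have P0 : P set0.
  apply/andP; split; first exact: consistentb0.
  by apply/forall_inP => a; rewrite inE.
have [T /andP[/consistentbP cT /forall_inP eT] maxT] := arg_maxnP (fun T => #|T|) P0.
have clT a b : a \in T -> connect (edge S) a b -> b \in T.
  move=> aT /connectP[t]; elim: t a aT => [|z t IHt] a aT /= => [_ ->|/andP[az zt]] //.
  by apply: IHt => //; have /forallP/(_ z)/implyP := eT _ aT; apply.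
have total z : (z \in T) || (lit_neg z \in T).
  apply: contraT; rewrite negb_or => /andP[zT nzT].
  wlog nz : z zT nzT / ~~ connect (edge S) z (lit_neg z).
    move=> wl; case: (boolP (connect (edge S) z (lit_neg z))) => [zz|]; last exact: wl.
    apply: (wl (lit_neg z)) => //; rewrite lit_negK//.
    by apply/negP => zz'; apply: noc; exists z.
  have /maxT : P (T :|: [set y | connect (edge S) z y]).
    apply/andP; split.
      have hz y : connect (edge S) z y -> connect (edge S) z (lit_neg y) -> False.
        move=> zy /connect_contra; rewrite lit_negK => yz.
        by rewrite (connect_trans zy yz) in nz.
      have hT y : y \in T -> connect (edge S) z (lit_neg y) -> False.
        move=> yT /connect_contra; rewrite lit_negK => /(clT _ _ yT).
        by rewrite (negPf nzT).
      apply/consistentbP => y; rewrite !inE => /orP[yT|zy]; rewrite negb_or.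
        by rewrite cT//=; apply/negP => /(hT _ yT).
      apply/andP; split; last by apply/negP => /(hz _ zy).
      by apply/negP => /hT; rewrite lit_negK; apply.
    apply/forall_inP => a; rewrite !inE => aT; apply/forallP => b; apply/implyP => ab.
    rewrite !inE; case/orP: aT => [aT|za].
      by rewrite (clT _ _ aT (connect1 ab)).
    by rewrite (connect_trans za (connect1 ab)) orbT.
  rewrite /= leqNgt proper_card// properE subsetUl /=.
  by apply/negP => /fintype.subsetP/(_ z); rewrite !inE connect0 orbT (negPf zT) => /(_ isT).
apply/sat_withP; exists [ffun v => (v, true) \in T].
have evT l : l \in T -> lit_eval l [ffun v => (v, true) \in T].
  case: l => v [] lT; rewrite /lit_eval /= ffunE//.
  by apply/negP => /cT; rewrite /lit_neg /= lT.
split=> [l|c cS]; first by rewrite inE.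
have /clauses_onP[a [b [_ _ _ ce]]] := fintype.subsetP SV _ cS.
case/orP: (total a) => aT; first by exists a; rewrite ?evT// ce set21.
exists b; first by rewrite ce set22.
apply/evT/(clT _ _ aT)/connect1.
by rewrite /edge /= /implication lit_negK -ce.
Qed.

Lemma path_lits V S x t : S \subset clauses_on V -> path (edge S) x t -> {subset t <= lits V}.
Proof.
move=> SV; elim: t x => [|y t IHt] x //= /andP[xy /IHt yt] z; rewrite inE => /predU1P[->|/yt//].
have := fintype.subsetP SV _ xy; rewrite /implication mem_clauses_on inE.
by case/and3P.
Qed.

(** A bicycle, the obstruction counted by the first moment: a chain of
implications [t] on distinct variables, entered from the negation of one of its
own literals and left towards a variable that it already contains. To find it,
follow implications from [x] to its negation until a variable repeats, which
gives a literal [y'] implying its negation [y]; then continue from [y] back to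
[y'] until a variable repeats again. *)
Lemma unsat_bicycle V S : S \subset clauses_on V -> ~~ sat_with set0 S ->
  exists t y l, [/\ {subset t <= lits V}, uniq [seq k.1 | k <- t], y \in t,
    l.1 \in [seq k.1 | k <- t] & path (edge S) (lit_neg y) (rcons t l)].
Proof.
move=> SV /(unsat_contradictory SV)[x [/connectP[p0 /shortenP[p xp up _ lp]] nxx]].
have xnx : x.1 \in [seq k.1 | k <- p].
  have -> : x.1 = (last x p).1 by rewrite -lp.
  apply: map_f; case: {xp up} p lp => [/= e|z p _]; last by rewrite /= mem_last.
  by have := lit_neg_neq x; rewrite e eqxx.
have [|s1 [y [s2 [ps us1 ys1]]]] := @first_dup _ _ (fun k : literal n => k.1) (x :: p).
  by rewrite /= xnx.
(* Literals do not repeat on a shortened path, so the repeated variable has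
   changed its sign. *)
have [y' y's1 y'y] : exists2 y', y' \in s1 & y'.1 = y.1.
  by have /mapP[y' ? ?] := ys1; exists y'.
have {y'y} y'E : y' = lit_neg y.
  case: (lit_var_eq y'y) => // e; move: up; rewrite ps cat_uniq /= => /and3P[_ + _].
  by rewrite negb_or -e y's1.
case/splitPr: y's1 us1 ps ys1 => s11 s12 us1 ps ys1.
have xsorted : sorted (edge S) (x :: p) by [].
have : sorted (edge S) (y' :: rcons s12 y ++ s2).
  move: xsorted; rewrite ps -catA => /cat_sorted2[_].
  by rewrite cat_rcons.
rewrite /= cat_path last_rcons => /andP[y'y yx].
have lp2 : last y s2 = lit_neg x by rewrite lp -(last_cons x x) ps last_cat.
have xy' : connect (edge S) x y'.
  apply: (path_connect (p := p)) => //; rewrite ps -catA mem_cat.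
  by rewrite inE eqxx !orbT.
have /connectP[p2 yp2 lp2'] : connect (edge S) y (lit_neg y).
  rewrite -y'E; apply: connect_trans xy'; apply: connect_trans nxx.
  by apply/connectP; exists s2.
set w := rcons s12 y in y'y.
have uw : uniq [seq k.1 | k <- w].
  move: us1; rewrite map_cat cat_uniq /= => /and3P[_ _ /andP[ys12 us12]].
  by rewrite map_rcons rcons_uniq us12 andbT; rewrite y'E in ys12.
have [|t [l [rest [tl ut lt]]]] := @first_dup _ _ (fun k : literal n => k.1) (w ++ p2).
  rewrite map_cat cat_uniq negb_and negb_and negbK; apply/orP; right; apply/orP; left.
  apply/hasP; exists y.1; last by rewrite /w map_rcons mem_rcons mem_head.
  have -> : y.1 = (last y p2).1 by rewrite -lp2'.
  apply: map_f; case: {yp2} p2 lp2' => [/= e|z p2' _]; last by rewrite /= mem_last.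
  by have := lit_neg_neq y; rewrite e eqxx.
have pfull : path (edge S) (lit_neg y) (w ++ p2).
  by rewrite -y'E cat_path y'y /w last_rcons.
have ptl : path (edge S) (lit_neg y) (rcons t l).
  by move: pfull; rewrite tl -cat_rcons cat_path => /andP[].
exists t, y, l; split=> //.
  move=> k kt; apply: (path_lits SV ptl).
  by rewrite mem_rcons inE kt orbT.
have wt : (size w <= size t)%N.
  rewrite leqNgt; apply/negP => tw.
  have : rcons t l = take (size t).+1 w.
    have := congr1 (take (size t).+1) tl.
    rewrite take_cat -cat_rcons -(size_rcons t l) take_size_cat// size_rcons.
    case: ltnP => [_ <- //|wt]; have -> : (size t).+1 = size w.
      by apply/eqP; rewrite eqn_leq tw.
    by rewrite subnn take0 cats0 take_size => <-.
  move=> e; have : uniq [seq k.1 | k <- rcons t l].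
    by rewrite e map_take take_uniq.
  by rewrite map_rcons rcons_uniq lt.
have -> : t = w ++ take (size t - size w) p2.
  have := congr1 (take (size t)) tl; rewrite (take_size_cat _ (erefl (size t))) take_cat.
  by rewrite ltnNge wt /= => /esym.
by rewrite mem_cat /w mem_rcons mem_head.
Qed.

Lemma mem_pairmap_implication c a t : c \in pairmap implication a t ->
  exists u v, [/\ u \in belast a t, v \in t & c = implication u v].
Proof.
elim: t a => [|b t IHt] a //=; rewrite inE => /predU1P[->|/IHt[u [v [ut vt ->]]]].
  by exists a, b; rewrite !mem_head.
by exists u, v; rewrite !inE ut vt !orbT.
Qed.

Lemma var_uniq_neq t x y : uniq [seq k.1 | k <- t] -> x \in t -> y \in t ->
  x != lit_neg y.
Proof.
move=> ut xt yt; apply/eqP => e.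
suff e' : x = y by move: (lit_neg_neq x); rewrite {1}e' -e eqxx.
have {e} : x.1 = y.1 by rewrite e.
elim: t ut xt yt => [|k t IHt] //= /andP[kt ut]; rewrite !inE.
case/predU1P => [->|xt] /predU1P[->|yt] // e.
- by case/negP: kt; rewrite e; exact: map_f.
- by case/negP: kt; rewrite -e; exact: map_f.
- exact: IHt.
Qed.

(** All clauses of a bicycle are distinct, whence a factor [p] for each: the clause
entering a literal of [t] contains that literal, no later clause inside [t] does,
and only the last clause contains the negation of the last literal of [t]. *)
Lemma implication_path_uniq t y l : uniq [seq k.1 | k <- t] -> y \in t ->
  uniq (pairmap implication (lit_neg y) (rcons t l)).
Proof.
move=> ut yt; rewrite -cats1 pairmap_cat cats1 rcons_uniq; apply/andP; split.
  apply/negP => /mem_pairmap_implication[u [v [uyt vt e]]].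
  case/lastP: t => [|t w] // in ut yt uyt vt e *.
  rewrite last_rcons in e; rewrite belast_rcons inE in uyt.
  have wt : w \in rcons t w by rewrite mem_rcons mem_head.
  have : lit_neg w \in implication u v by rewrite -e set21.
  rewrite !inE => /orP[/eqP/(can_inj (@lit_negK n)) wu|/eqP wv]; last first.
    by have := var_uniq_neq ut vt wt; rewrite wv eqxx.
  case/predU1P: uyt => uyt.
    by have := var_uniq_neq ut wt yt; rewrite wu uyt eqxx.
  by move: ut; rewrite map_rcons rcons_uniq wu map_f.
elim: t (lit_neg y) ut {yt} => [|b t IHt] a //= ut; rewrite IHt ?andbT; last by case/andP: ut.
apply/negP => /mem_pairmap_implication[u [v [ut' vt e]]].
have : b \in implication u v by rewrite -e set22.
rewrite !inE => /orP[]/eqP bE.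
  have := @var_uniq_neq (b :: t) b u ut (mem_head _ _) (mem_belast ut').
  by rewrite -bE eqxx.
by case/andP: ut => /negP + _; apply; rewrite bE map_f.
Qed.

Lemma path_edge S a t : path (edge S) a t = all (mem S) (pairmap implication a t).
Proof. by elim: t a => [|b t IHt] a //=; rewrite IHt. Qed.

Lemma card_lits V : #|lits V| = (2 * #|V|)%N.
Proof.
rewrite (_ : lits V = setX V [set: bool]) ?cardsX ?cardsT ?card_bool 1?mulnC//.
by apply/setP => -[v s]; rewrite !inE andbT.
Qed.

Lemma sumr_seq_const (R : realFieldType) (J : Type) (s : seq J) (c : R) :
  \sum_(j <- s) c = (size s)%:R * c.
Proof. by rewrite big_const_seq count_predT iter_addr_0 mulr_natl. Qed.

Lemma ler_sum_mem (R : realFieldType) (J : eqType) (s : seq J) (F : J -> R) j :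
  j \in s -> (forall i, 0 <= F i) -> F j <= \sum_(i <- s) F i.
Proof.
move=> js F0; rewrite (big_rem j)//= lerDl; exact: sumr_ge0.
Qed.

(** First moment of bicycles. With [r] literals there are at most
[(2 * #|V|) ^ r] chains, [r] ways to enter and [2 * r] ways to leave, and [r + 1]
clauses. *)
Lemma sat_with_empty_lower (R : realFieldType) (p d : R) V :
  0 <= p <= 1 -> 0 < d <= 1 -> 2 * (#|V|%:R * p) <= 1 - d ->
  1 - 6 * p / d ^+ 3 <= bernE p (enum (clauses_on V)) (fun S => (sat_with set0 S)%:R).
Proof.
move=> p01 d01 Vd; have /andP[p0 p1] := p01.
pose F r S : R := \sum_(t <- words (enum (lits V)) r) \sum_(y <- t)
  \sum_(l <- signed [seq k.1 | k <- t])
    ((uniq [seq k.1 | k <- t]) && (y \in t) && path (edge S) (lit_neg y) (rcons t l))%:R.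
have F0 r S : 0 <= F r S by do 3! (apply: sumr_ge0 => ? _).
have satF S : S \subset enum (clauses_on V) ->
    1 - \sum_(r < n.+1) F r S <= (sat_with set0 S)%:R.
  move=> /fintype.subsetP SV; have {}SV : S \subset clauses_on V.
    by apply/fintype.subsetP => c /SV; rewrite mem_enum.
  case: (boolP (sat_with set0 S)) => [_|/(unsat_bicycle SV)[t [y [l [tV ut yt lt ptl]]]]].
    by rewrite gerBl sumr_ge0.
  rewrite subr_le0.
  have tn : (size t < n.+1)%N.
    rewrite ltnS -(size_map (fun k : literal n => k.1)) -(card_uniqP ut).
    by rewrite -[leqRHS](card_ord n) max_card.
  have tw : t \in words (enum (lits V)) (size t).
    by apply: mem_words => k /tV; rewrite mem_enum.
  rewrite (bigD1 (Ordinal tn))//= -[leLHS]addr0 lerD ?sumr_ge0//.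
  apply: le_trans (ler_sum_mem tw _); last by move=> i; do 2! (apply: sumr_ge0 => ? _).
  apply: le_trans (ler_sum_mem yt _); last by move=> i; apply: sumr_ge0.
  apply: le_trans (@ler_sum_mem _ _ _ _ l _ _) => //; last by rewrite mem_signed.
  by rewrite ut yt ptl.
apply: le_trans (bernE_le p01 satF).
have -> : bernE p (enum (clauses_on V)) (fun S => 1 - \sum_(r < n.+1) F r S)
   = 1 - \sum_(r < n.+1) bernE p (enum (clauses_on V)) (F r).
  rewrite -bernE_sum.
  have /= := bernE_linear p (enum (clauses_on V)) (fun=> 1) (fun S => \sum_(r < n.+1) F r S) 1 (-1).
  rewrite bernE_cst mulr1 mulN1r => <-.
  by apply: eq_bernE => S; rewrite mulN1r.
rewrite lerD2l lerN2.
pose x := 2 * (#|V|%:R * p).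
have x0 : 0 <= x by rewrite !mulr_ge0.
apply: le_trans (_ : 2 * p * (\sum_(r < n.+1) r%:R ^+ 2 * x ^+ r) <= _); last first.
  rewrite (_ : 6 * p / d ^+ 3 = 2 * p * (3 / d ^+ 3)); last by ring.
  by rewrite ler_wpM2l ?mulr_ge0// sum_sqr_geom.
rewrite mulr_sumr; apply: ler_sum => r _; rewrite bernE_sum.
apply: le_trans (_ : \sum_(t <- words (enum (lits V)) r)
    (r%:R * ((2 * r)%:R * p ^+ r.+1)) <= _); last first.
  rewrite sumr_seq_const size_words -cardE card_lits /x.
  rewrite natrX natrM natrM exprMn exprMn exprMn !exprS le_eqVlt; apply/orP; left; apply/eqP.
  by ring.
rewrite [leLHS]big_seq [leRHS]big_seq; apply: ler_sum => t /size_of_words tr.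
rewrite -tr -sumr_seq_const bernE_sum; apply: ler_sum => y _.
have -> : (2 * size t)%N = size (signed [seq k.1 | k <- t]).
  by elim: t {tr} => //= k t IHt; rewrite mulnS IHt.
rewrite -sumr_seq_const bernE_sum; apply: ler_sum => l _.
case: (boolP (uniq _ && _)) => [/andP[ut yt]|_] /=; last first.
  by rewrite bernE_cst exprn_ge0.
have -> : (size t).+1 = size (pairmap implication (lit_neg y) (rcons t l)).
  by rewrite size_pairmap size_rcons.
rewrite (@eq_bernE _ _ _ _ _ (fun S =>
    (all (mem S) (pairmap implication (lit_neg y) (rcons t l)))%:R)).
  by apply: bernE_all_present; rewrite ?enum_uniq// implication_path_uniq.
by move=> S; rewrite path_edge.
Qed.
End Bicycle.

(** * Satisfiability in the critical window *)

(** Jensen's inequality for the exponential, through its tangent at the mean. *)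
Lemma binE_jensen (R : realType) (r : R) k b (G : nat -> R) : 0 <= r <= 1 ->
  expR (- binE r k b G) <= binE r k b (fun a => expR (- G a)).
Proof.
move=> /andP[r0 r1]; elim: k b => [|k IHk] b //=.
apply: le_trans (_ : (1 - r) * expR (- binE r k b G) + r * expR (- binE r k b.+1 G) <= _);
  last by rewrite lerD// ler_wpM2l// subr_ge0.
set X := binE _ _ _ _; set Y := binE _ _ _ _; set m := (1 - r) * X + r * Y.
have tangent x : expR (- m) * (1 + (m - x)) <= expR (- x).
  rewrite [in leRHS](_ : - x = - m + (m - x)); last by ring.
  by rewrite expRD ler_wpM2l ?expR_ge0 ?expR_ge1Dx.
have -> : expR (- m) = (1 - r) * (expR (- m) * (1 + (m - X))) + r * (expR (- m) * (1 + (m - Y))).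
  by rewrite {3 5}/m; ring.
by rewrite lerD// ler_wpM2l// subr_ge0.
Qed.

Lemma expR_le_1B (R : realType) (x : R) : 0 <= x <= 2 / 3 -> expR (- (3 * x)) <= 1 - x.
Proof.
move=> /andP[x0 x1]; rewrite expRN -div1r ler_pdivrMr ?expR_gt0//.
have h := expR_ge1Dx (3 * x).
apply: le_trans (_ : (1 - x) * (1 + 3 * x) <= _); first by nra.
by rewrite ler_wpM2l//; lra.
Qed.

(** On a logarithmic scale, Jensen's inequality reduces one step to a comparison
of means: [G] has to decrease in the mean by the conflict term
[3 * (#|A|%:R * p)]. *)
Lemma sat_with_log_step (R : realType) n (p C : R) (G : nat -> R)
    (V : {set 'I_n}) (A : {set literal n}) x :
  0 <= p < 1 -> n%:R * p <= 2 / 3 -> 0 <= C ->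
  x \in A -> A \subset lits V -> consistent A ->
  (forall B : {set literal n}, B \subset lits (V :\ x.1) -> consistent B ->
    C * expR (- G #|B|) <=
    bernE p (enum (clauses_on (V :\ x.1))) (fun S => (sat_with B S)%:R)) ->
  exists2 u, (u <= #|V|)%N &
    C * expR (- (3 * (#|A|%:R * p) + binE (2 * p / (1 + p)) u #|A|.-1 G)) <=
    bernE p (enum (clauses_on V)) (fun S => (sat_with A S)%:R).
Proof.
move=> p01 pn C0 xA AV cA IH.
have p01' : 0 <= p <= 1 by case/andP: p01 => -> /ltW ->.
have /andP[p0 p1] := p01'.
have [r0 _ r1 _] := binE_rate p01'.
have [||u /andP[_ uV]] := @step_lower _ _ _ V A x xA AV cA p01 sat_with
    (fun a => C * expR (- G a)) sat_with_propagates; [|exact: IH|].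
  by move=> B1 B2 S B12; exact: sat_withS.
move=> h; exists u => //; apply: le_trans h.
have a0 : (0 < #|A|)%N by apply/card_gt0P; exists x.
have nn0 : 0 <= n%:R * p by rewrite mulr_ge0.
have up : u%:R * p <= 1.
  apply: le_trans (_ : n%:R * p <= _); last lra.
  by rewrite ler_wpM2r// ler_nat (leq_trans uV)// card_set_ord.
have An : (#|A| <= n)%N.
  have inj : {in A &, injective (fun l : literal n => l.1)}.
    move=> l k lA kA /lit_var_eq[//|e]; have := cA _ kA.
    by rewrite -e lA.
  by rewrite -(card_in_imset inj) card_set_ord.
have ap : 0 <= #|A|%:R * p <= 2 / 3.
  rewrite mulr_ge0//=; apply: le_trans pn.
  by rewrite ler_wpM2r// ler_nat.
have /andP[w1 _] := no_conflict_weight p01' a0 up.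
rewrite [leRHS]mulrA opprD expRD.
rewrite (@eq_binE _ _ _ _ (fun a => C * _) (fun a => C * expR (- G a) + 0 * 0));
  last by move=> a; rewrite mul0r addr0.
rewrite (binE_linear _ _ _ _ (fun=> 0)) mul0r addr0 mulrCA.
apply: ler_pM; rewrite ?expR_ge0 ?mulr_ge0 ?expR_ge0//.
  by apply: le_trans w1; exact: expR_le_1B.
by rewrite ler_wpM2l// binE_jensen// r0.
Qed.

(** The queue has drift at most [- d]. The decrease of the quadratic term of the
exponent pays for the conflicts, and that of the linear term for the variance of
the queue, which the quadratic term turns into a cost. When the queue is empty,
the remaining formula only has to be satisfiable. *)
Lemma sat_with_subcritical (R : realType) n (p d : R) :
  0 <= p < 1 -> n%:R * p <= 2 / 3 -> 0 < d <= 1 ->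
  (forall V : {set 'I_n}, 2 * (#|V|%:R * p) <= 1 - d ->
    1 / 2 <= bernE p (enum (clauses_on V)) (fun S => (sat_with set0 S)%:R)) ->
  forall (V : {set 'I_n}) (A : {set literal n}),
  A \subset lits V -> consistent A -> 2 * (#|V|%:R * p) <= 1 - d ->
  1 / 2 * expR (- (3 * p / d ^+ 2 * #|A|%:R + 3 * p / (2 * d) * #|A|%:R ^+ 2)) <=
  bernE p (enum (clauses_on V)) (fun S => (sat_with A S)%:R).
Proof.
move=> p01 pn /andP[d0 d1] base V A.
have p01' : 0 <= p <= 1 by case/andP: p01 => -> /ltW ->.
have /andP[p0 p1] := p01'.
have [r0 r2p r1 _] := binE_rate p01'.
have [k] := ubnP #|V|; elim: k V A => // k IHk V A Vk AV cA Vd.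
have [A0|[x xA]] := set_0Vmem A.
  rewrite A0 cards0 expr0n !mulr0 addr0 oppr0 expR0 mulr1; exact: base.
have a0 : (0 < #|A|)%N by apply/card_gt0P; exists x.
have xV : x.1 \in V by have := fintype.subsetP AV _ xA; rewrite inE.
have V'k : (#|V :\ x.1| < k)%N by move: Vk; rewrite (cardsD1 x.1 V) xV.
have h20 : 0 <= 1 / 2 :> R by lra.
have [|u uV] := @sat_with_log_step _ _ p (1 / 2)
   (fun a => 3 * p / d ^+ 2 * a%:R + 3 * p / (2 * d) * a%:R ^+ 2) V A x p01 pn h20 xA AV cA.
  move=> B BV cB; apply: IHk => //; apply: le_trans Vd.
  by rewrite ler_wpM2l// ler_wpM2r// ler_nat subset_leq_card// subD1set.
apply: le_trans; rewrite ler_wpM2l// ler_expR lerN2.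
set r := 2 * p / (1 + p) in r0 r2p r1 *.
rewrite (@eq_binE _ r _ _ _ (fun a => 0 + 3 * p / d ^+ 2 * a%:R + 3 * p / (2 * d) * a%:R ^+ 2));
  last by move=> a; rewrite add0r.
rewrite binE_quad add0r.
have ea : #|A|%:R = #|A|.-1%:R + 1 :> R by rewrite natr1 prednK.
have ur1 : u%:R * r <= 1 - d.
  apply: le_trans Vd; have : u%:R * r <= #|V|%:R * (2 * p) by apply: ler_pM; rewrite // ler_nat.
  by lra.
have ur0 : 0 <= u%:R * r by rewrite mulr_ge0.
set s := u%:R * r in ur1 ur0 *.
have b0 : 0 <= #|A|.-1%:R :> R by [].
have mA : #|A|.-1%:R + s <= #|A|%:R - d by rewrite ea; lra.
have m0 : 0 <= #|A|.-1%:R + s by rewrite addr_ge0.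
set m := _ + s in mA m0 *; set a := #|A|%:R in mA *.
have v1 : s * (1 - r) <= 1 by rewrite mulr_ile1//; lra.
have m2 : m ^+ 2 <= (a - d) ^+ 2 by apply: lerXn2r; rewrite ?nnegrE//; lra.
have c20 : 0 <= 3 * p / (2 * d) by rewrite divr_ge0 ?mulr_ge0// ltW.
have c10 : 0 <= 3 * p / d ^+ 2 by apply: divr_ge0; [rewrite mulr_ge0|rewrite exprn_ge0 ?ltW].
apply: le_trans (_ : 3 * (a * p) +
    (3 * p / d ^+ 2 * (a - d) + 3 * p / (2 * d) * ((a - d) ^+ 2 + 1)) <= _).
  by rewrite lerD2l lerD// ler_wpM2l//; lra.
have dn0 : d != 0 by rewrite gt_eqF.
rewrite -subr_ge0; set X := (X in 0 <= X).
have -> : X = 3 * p / (2 * d) * (1 - d ^+ 2) by rewrite /X; field.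
by rewrite mulr_ge0// subr_ge0 expr_le1// ltW.
Qed.

(** Above [vs] variables the drift is only known to be at most [d0], and an empty
queue is refilled with an arbitrary literal. The exponent is quadratic in the
queue length, so a refill from length [0] to [1] costs no more than a step does
anyway, and its coefficients grow with the number [q] of steps that may be left.
The last hypothesis, on real queue lengths [a], says that one unit of [q] pays for
one step. *)
Lemma sat_with_window (R : realType) n (p d0 vs Q al0 al1 ga0 ga1 : R) :
  0 <= p < 1 -> n%:R * p <= 2 / 3 -> 0 <= vs -> 2 * (n%:R * p) <= 1 + d0 -> 0 <= d0 <= 1 / 2 ->
  [/\ 0 <= al0, 0 <= al1, 0 <= ga0 & 0 <= ga1] ->
  (forall (V : {set 'I_n}) (A : {set literal n}),
    A \subset lits V -> consistent A -> #|V|%:R <= vs ->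
    1 / 2 * expR (- (al0 + ga0 * #|A|%:R ^+ 2)) <=
    bernE p (enum (clauses_on V)) (fun S => (sat_with A S)%:R)) ->
  (forall a : R, 1 <= a ->
    3 * (a * p) + (ga0 + ga1 * Q) * (2 * d0 * a + 4) <= al1 + ga1 * a ^+ 2) ->
  forall (V : {set 'I_n}) (A : {set literal n}) (q : R),
  A \subset lits V -> consistent A -> 0 <= q <= Q ->
  #|V|%:R <= vs \/ #|V|%:R <= vs + q - 1 ->
  1 / 2 * expR (- (al0 + al1 * q + (ga0 + ga1 * q) * (maxn #|A| 1)%:R ^+ 2)) <=
  bernE p (enum (clauses_on V)) (fun S => (sat_with A S)%:R).
Proof.
move=> p01 pn vs0 pd /andP[d00 d01] [al00 al10 ga00 ga10] base drift V A q.
have p01' : 0 <= p <= 1 by case/andP: p01 => -> /ltW ->.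
have /andP[p0 p1] := p01'.
have [r0 r2p r1 _] := binE_rate p01'.
have h20 : 0 <= 1 / 2 :> R by lra.
have [k] := ubnP #|V|; elim: k V A q => // k IHk V A q Vk AV cA /andP[q0 qQ] Vq.
have [Vs|Vs] := leP #|V|%:R vs.
  apply: le_trans (base V A AV cA Vs).
  rewrite ler_wpM2l// ler_expR lerN2 lerD//.
    by rewrite lerDl mulr_ge0.
  apply: ler_pM; rewrite ?sqr_ge0//; first by rewrite lerDl mulr_ge0.
  by apply: lerXn2r; rewrite ?nnegrE// ler_nat leq_maxl.
have {Vq} Vq : #|V|%:R <= vs + q - 1 by case: Vq => // ?; lra.
wlog [x xA] : A AV cA / exists x, x \in A.
  move=> wl; have [A0|[x xA]] := set_0Vmem A; last by apply: wl => //; exists x.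
  have /card_gt0P[v vV] : (0 < #|V|)%N by rewrite -(ltr_nat R); lra.
  have := wl [set (v, true)] _ _ _; rewrite A0 cards0 cards1 /= => h.
  apply: le_trans (h _ _ _) _.
  - by apply/fintype.subsetP => l /set1P ->; rewrite inE.
  - by move=> l /set1P ->; rewrite inE lit_neg_neq.
  - by exists (v, true); rewrite set11.
  apply: bernE_le => // S _; rewrite ler_nat; case e: (sat_with _ S) => //.
  by rewrite lt0b (sat_withS _ _ e)// sub0set.
have a0 : (0 < #|A|)%N by apply/card_gt0P; exists x.
have xV : x.1 \in V by have := fintype.subsetP AV _ xA; rewrite inE.
have V'k : (#|V :\ x.1| < k)%N by move: Vk; rewrite (cardsD1 x.1 V) xV.
have q10 : 0 <= q - 1 by lra.
pose ga := ga0 + ga1 * (q - 1).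
have [|u uV] := @sat_with_log_step _ _ p (1 / 2)
   (fun a => al0 + al1 * (q - 1) + ga * (maxn a 1)%:R ^+ 2) V A x p01 pn h20 xA AV cA.
  move=> B BV cB; apply: IHk => //; first by rewrite q10 /=; lra.
  right; have : #|V|%:R = 1 + #|V :\ x.1|%:R :> R by rewrite (cardsD1 x.1 V) xV add1n -natr1 addrC.
  lra.
apply: le_trans; rewrite ler_wpM2l// ler_expR lerN2.
have /maxn_idPl -> : (1 <= #|A|)%N by [].
set r := 2 * p / (1 + p) in r0 r2p r1 *.
have gage0 : 0 <= ga by rewrite addr_ge0// mulr_ge0.
have ea : #|A|%:R = #|A|.-1%:R + 1 :> R by rewrite natr1 prednK.
have a1 : 1 <= #|A|%:R :> R by rewrite ler1n.
have ur1 : u%:R * r <= 1 + d0.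
  apply: le_trans pd; have : u%:R * r <= n%:R * (2 * p).
    by apply: ler_pM; rewrite // ler_nat (leq_trans uV)// card_set_ord.
  by lra.
have ur0 : 0 <= u%:R * r by rewrite mulr_ge0.
have le1 : binE r u #|A|.-1 (fun a => al0 + al1 * (q - 1) + ga * (maxn a 1)%:R ^+ 2) <=
    binE r u #|A|.-1 (fun a => (al0 + al1 * (q - 1) + ga) + 0 * a%:R + ga * a%:R ^+ 2).
  apply: binE_le; first by rewrite r0.
  move=> a; rewrite mul0r addr0.
  have : ga * (maxn a 1)%:R ^+ 2 <= ga * (1 + a%:R ^+ 2).
    rewrite ler_wpM2l//; case: a => [|a]; first by rewrite expr0n addr0 expr1n.
    by rewrite (_ : maxn _ _ = a.+1)// lerDr.
  by lra.
apply: le_trans (lerD (lexx _) le1) _; rewrite binE_quad mul0r addr0.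
set s := u%:R * r in ur1 ur0 *.
have b0 : 0 <= #|A|.-1%:R :> R by [].
have mA : #|A|.-1%:R + s <= #|A|%:R + d0 by rewrite ea; lra.
have m0 : 0 <= #|A|.-1%:R + s by rewrite addr_ge0.
set m := _ + s in mA m0 *.
have v1 : s * (1 - r) <= 1 + d0.
  by apply: le_trans ur1; rewrite -[leRHS]mulr1 ler_wpM2l//; lra.
have m2 : m ^+ 2 <= (#|A|%:R + d0) ^+ 2 by apply: lerXn2r; rewrite ?nnegrE//; lra.
have dd : d0 * d0 <= 1 by rewrite mulr_ile1//; lra.
have dr := drift _ a1; set a := #|A|%:R in a1 mA m2 dr *.
have le2 : ga * (m ^+ 2 + s * (1 - r)) <= ga * (a ^+ 2 + 2 * d0 * a + 3).
  by rewrite ler_wpM2l//; move: m2; rewrite !expr2; lra.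
have le3 : ga * (2 * d0 * a + 4) <= (ga0 + ga1 * Q) * (2 * d0 * a + 4).
  rewrite ler_wpM2r//; first by rewrite addr_ge0// !mulr_ge0//; lra.
  by rewrite lerD2l ler_wpM2l//; lra.
have -> : (ga0 + ga1 * q) * a ^+ 2 = ga * a ^+ 2 + ga1 * a ^+ 2 by rewrite /ga; ring.
lra.
Qed.

(** * Independent uniform draws versus Bernoulli inclusions *)

Section Draws.
Context {R : realFieldType} {I : finType} (m : nat).
Implicit Types (S : {set I}) (f g h : {set I} -> R).

Definition image_set (phi : {ffun 'I_m -> I}) : {set I} := [set phi j | j in 'I_m].

(** Independent uniform draws may coincide, and [f] only sees which values occur. *)
Definition drawE f : R := (#|I|%:R ^- m) * \sum_(phi : {ffun 'I_m -> I}) f (image_set phi).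

Hypothesis I0 : (0 < #|I|)%N.

Lemma drawE_cst (x : R) : drawE (fun=> x) = x.
Proof.
rewrite /drawE big_const iter_addr_0 card_ffun card_ord -(mulr_natl x) natrX mulrA mulVf ?mul1r//.
by rewrite expf_neq0// pnatr_eq0 -lt0n.
Qed.

Lemma drawE_le f g : (forall phi, f (image_set phi) <= g (image_set phi)) -> drawE f <= drawE g.
Proof. by move=> fg; rewrite ler_wpM2l ?invr_ge0 ?exprn_ge0// ler_sum. Qed.

Lemma drawE_linear f g (x y : R) :
  drawE (fun S => x * f S + y * g S) = x * drawE f + y * drawE g.
Proof. by rewrite /drawE big_split/= -!mulr_sumr mulrDr !(mulrCA (_ ^- _)). Qed.

(** Each value is missed with probability [(1 - #|I|^-1) ^+ m]. *)
Lemma drawE_card : m%:R - m%:R ^+ 2 / #|I|%:R <= drawE (fun S => #|S|%:R).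
Proof.
set M := #|I|%:R : R; have M0 : 0 < M by rewrite ltr0n.
have M1 : 1 <= M by rewrite ler1n.
have -> : drawE (fun S => #|S|%:R) = M * (1 - (1 - M^-1) ^+ m).
  have -> : drawE (fun S => #|S|%:R) =
      M ^- m * \sum_(phi : {ffun 'I_m -> I}) \sum_(c : I) (c \in image_set phi)%:R.
    congr (_ * _); apply: eq_bigr => phi _.
    by rewrite -natr_sum -sum1_card big_mkcond.
  rewrite exchange_big /=.
  have eqc c : \sum_(phi : {ffun 'I_m -> I}) (c \in image_set phi)%:R = M ^+ m - (M - 1) ^+ m.
    have -> : M ^+ m = \sum_(phi : {ffun 'I_m -> I}) 1.
      by rewrite sumr_const card_ffun card_ord natrX.
    have -> : (M - 1) ^+ m = \sum_(phi : {ffun 'I_m -> I}) (c \notin image_set phi)%:R.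
      rewrite -natr_sum -(big_mkcond (fun phi => c \notin image_set phi) (fun=> 1%N)) /= sum1_card.
      have := @card_ffun_on 'I_m I (predC1 c); rewrite card_ord cardC1 => e.
      rewrite (_ : M - 1 = #|I|.-1%:R); last by rewrite /M -{1}(prednK I0) -natr1 addrK.
      rewrite -natrX -e; congr (_%:R); apply: eq_card => phi; rewrite !inE.
      apply/ffun_onP/idP => [H|H j].
        by apply/imsetP => -[j _ cj]; have := H j; rewrite inE -cj eqxx.
      by rewrite inE; apply: contra H => /eqP <-; apply: imset_f.
    by rewrite -sumrB; apply: eq_bigr => phi _; case: (_ \in _); rewrite ?subr0 ?subrr.
  rewrite (eq_bigr _ (fun c _ => eqc c)) sumr_const -mulr_natl -/M.
  have -> : (1 - M^-1) ^+ m = (M - 1) ^+ m * M ^- m.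
    by rewrite -exprVn -exprMn mulrBl divff ?gt_eqF// mul1r.
  rewrite mulrCA mulrBr mulVf ?expf_neq0 ?gt_eqF//; ring.
have V01 : 0 <= M^-1 <= 1 by rewrite invr_ge0 ltW//= invf_le1.
have := pow1B_mul_le1 m V01; have : 0 <= (1 - M^-1) ^+ m.
  by rewrite exprn_ge0// subr_ge0; case/andP: V01.
set q := _ ^+ m => q0 hq; have m0 : 0 <= m%:R :> R by [].
have q' : q * (M + m%:R) <= M.
  have -> : q * (M + m%:R) = (q * (1 + m%:R / M)) * M by field; rewrite gt_eqF.
  by rewrite -[leRHS]mul1r ler_wpM2r// ltW.
have : (m%:R - m%:R ^+ 2 / M) * (M + m%:R) <= M * (1 - q) * (M + m%:R).
  apply: le_trans (_ : M * m%:R <= _).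
    have -> : (m%:R - m%:R ^+ 2 / M) * (M + m%:R) = M * m%:R - m%:R ^+ 3 / M.
      by field; rewrite gt_eqF.
    by rewrite gerBl divr_ge0 ?exprn_ge0// ltW.
  rewrite -mulrA ler_wpM2l ?(ltW M0)//; lra.
by rewrite ler_pM2r// ltr_wpDr.
Qed.

(** The Markov inequality for the number of draws lost to collisions. *)
Lemma drawE_few (d : R) : d < m%:R ->
  drawE (fun S => (#|S|%:R < d)%R%:R) <= m%:R ^+ 2 / #|I|%:R / (m%:R - d).
Proof.
move=> dm; rewrite ler_pdivlMr ?subr_gt0//.
have -> : drawE (fun S => (#|S|%:R < d)%R%:R) * (m%:R - d) =
          drawE (fun S => (m%:R - d) * (#|S|%:R < d)%R%:R + 0 * 0).
  by rewrite (drawE_linear _ (fun=> 0)) mul0r addr0 mulrC.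
apply: le_trans (_ : drawE (fun S => m%:R * 1 + (-1) * #|S|%:R) <= _).
  apply: drawE_le => phi; rewrite mul0r addr0 mulr1 mulN1r.
  have cm : #|image_set phi|%:R <= m%:R :> R.
    by rewrite ler_nat -[leqRHS](card_ord m) leq_imset_card.
  case: ltP => hd; rewrite ?mulr1 ?mulr0 ?subr_ge0//; lra.
rewrite (drawE_linear (fun=> 1)) drawE_cst.
by have := drawE_card; lra.
Qed.

End Draws.

Section Transfer.
Context {R : realFieldType} {I : finType} (m : nat) (h : {set I} -> R).
Hypotheses (I0 : (0 < #|I|)%N) (h01 : forall S, 0 <= h S <= 1).
Hypothesis hanti : forall S S' : {set I}, S \subset S' -> h S' <= h S.

(* Summing over all relabelings of [I] changes neither mean, up to the factor
   [P], and leaves a function of the cardinality alone, which is decreasing. *)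
Let G (S : {set I}) : R := \sum_(s : {perm I}) h [set s x | x in S].
Let P : R := #|{perm I}|%:R.

Let P0 : 0 < P.
Proof. by rewrite ltr0n; apply/card_gt0P; exists 1%g. Qed.

Lemma perm_into (S S' : {set I}) : (#|S| <= #|S'|)%N ->
  exists s : {perm I}, [set s x | x in S] \subset S'.
Proof.
move=> SS'; pose e (T : {set I}) := enum T ++ enum (~: T).
have ue T : uniq (e T).
  rewrite cat_uniq !enum_uniq andbT /=; apply/hasPn => x.
  by rewrite !mem_enum inE.
have me T x : x \in e T by rewrite mem_cat !mem_enum inE orbN.
have se T : size (e T) = #|I| by rewrite size_cat -!cardE cardsC.
pose g x := nth x (e S') (index x (e S)).
have ix x : (index x (e S) < #|I|)%N by rewrite -(se S) index_mem.
have ginj : injective g.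
  move=> x y /eqP; rewrite /g (set_nth_default y) ?se//.
  rewrite nth_uniq ?se// => /eqP ixy.
  by rewrite -(nth_index y (me S x)) ixy nth_index.
exists (perm ginj); apply/fintype.subsetP => y /imsetP[x xS ->].
rewrite permE /g nth_cat.
have : (index x (e S) < size (enum S'))%N.
  apply: leq_trans (_ : #|S| <= _)%N; last by rewrite -cardE.
  by rewrite index_cat mem_enum xS cardE index_mem mem_enum.
by move=> lt; rewrite lt -mem_enum mem_nth.
Qed.

Let G_anti (S S' : {set I}) : (#|S| <= #|S'|)%N -> G S' <= G S.
Proof.
move=> /perm_into[s sS]; rewrite /G [leRHS](reindex_inj (mulgI s)) /=.
apply: ler_sum => t _; apply: hanti; apply/fintype.subsetP => y /imsetP[x xS ->].
by rewrite permM; apply: imset_f; apply: (fintype.subsetP sS); apply: imset_f.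
Qed.

Let G01 S : 0 <= G S <= P.
Proof.
apply/andP; split; first by apply: sumr_ge0 => s _; case/andP: (h01 [set s x | x in S]).
apply: le_trans (_ : \sum_(s : {perm I}) 1 <= _); last by rewrite sumr_const.
by apply: ler_sum => s _; case/andP: (h01 [set s x | x in S]).
Qed.

Let bernE_G p : bernE p (enum I) G = P * bernE p (enum I) h.
Proof.
rewrite bernE_sum -[P]/(_%:R) mulr_natl -sumr_const; apply: eq_bigr => s _.
rewrite -(bernE_map p s (enum I) h); apply: bernE_perm; apply: uniq_perm.
- by rewrite map_inj_uniq ?enum_uniq//; exact: perm_inj.
- exact: enum_uniq.
move=> x; rewrite mem_enum inE -(permKV s x) mem_map ?mem_enum//; exact: perm_inj.
Qed.

Let drawE_G : drawE m G = P * drawE m h.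
Proof.
rewrite /drawE mulrCA; congr (_ * _); rewrite exchange_big /= -[P]/(_%:R) mulr_natl -sumr_const.
apply: eq_bigr => s _.
have inj : injective (fun phi : {ffun 'I_m -> I} => [ffun j => s (phi j)]).
  move=> phi psi /ffunP e; apply/ffunP => j; have := e j.
  by rewrite !ffunE; exact: perm_inj.
rewrite [RHS](reindex_inj inj) /=; apply: eq_bigr => phi _; congr (h _).
rewrite /image_set -imset_comp; apply: eq_imset => j; by rewrite /= ffunE.
Qed.

(** The two models are compared through the numbers of distinct elements: a set
with at least [m] elements is less favourable to the decreasing [h] than any
outcome of [m] draws. *)
Lemma bernE_le_drawE (p : R) : 0 <= p <= 1 ->
  bernE p (enum I) h <= bernE p (enum I) (fun S => (#|S| < m)%N%:R) + drawE m h.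
Proof.
move=> p01; rewrite -(ler_pM2l P0) mulrDr -bernE_G -drawE_G -bernEZ.
have -> : drawE m G = bernE p (enum I) (fun=> drawE m G) by rewrite bernE_cst.
rewrite -bernED; apply: bernE_le => // S _.
have [S0|mS] := ltnP; last first.
  rewrite mulr0 add0r -[leLHS](drawE_cst m I0); apply: drawE_le => phi.
  by apply: G_anti; apply: leq_trans mS; rewrite -[leqRHS](card_ord m) leq_imset_card.
rewrite mulr1; apply: le_trans (_ : P + 0 <= _); first by rewrite addr0; case/andP: (G01 S).
rewrite lerD2l -[leLHS](drawE_cst m I0); apply: drawE_le => phi.
by case/andP: (G01 (image_set phi)).
Qed.

(** Conversely, draws with at least [d] distinct values are less favourable than
any set with at most [d] elements. *)
Lemma drawE_le_bernE (p d : R) : 0 <= p <= 1 ->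
  drawE m h * bernE p (enum I) (fun S => (#|S|%:R <= d)%R%:R)
  <= drawE m (fun S : {set I} => (#|S|%:R < d)%R%:R) + bernE p (enum I) h.
Proof.
move=> p01; rewrite -(ler_pM2l P0) mulrDr -bernE_G mulrA -drawE_G.
set b := bernE p _ (fun S => (_ <= _)%R%:R).
have b01 : 0 <= b <= 1.
  apply/andP; split; first by apply: bernE_ge_cst => // S _.
  by apply: bernE_le_cst => // S _; rewrite -[leRHS]/(1%:R) ler_nat leq_b1.
have -> : drawE m G * b = drawE m (fun S => b * G S + 0 * 0).
  by rewrite (drawE_linear _ _ (fun=> 0)) mul0r addr0 mulrC.
have -> : P * drawE m (fun S : {set I} => (#|S|%:R < d)%R%:R) + bernE p (enum I) G =
    drawE m (fun S : {set I} => P * (#|S|%:R < d)%R%:R + bernE p (enum I) G * 1).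
  by rewrite (drawE_linear _ _ (fun=> 1)) drawE_cst// mulr1.
have /andP[b0 b1] := b01.
apply: drawE_le => phi; rewrite mul0r addr0 mulr1.
have /andP[g0 g1] := G01 (image_set phi).
case: ltP => hd.
  rewrite mulr1; apply: le_trans (_ : P + 0 <= _).
    by rewrite addr0; apply: le_trans (_ : 1 * P <= _); [apply: ler_pM|rewrite mul1r].
  by rewrite lerD2l; apply: bernE_ge_cst => // S _; case/andP: (G01 S).
rewrite mulr0 add0r mulrC -bernEZ; apply: bernE_le => // S _.
case: (leP #|S|%:R d) => Sd; last by rewrite mulr0; case/andP: (G01 S).
by rewrite mulr1; apply: G_anti; rewrite -(ler_nat R) (le_trans Sd).
Qed.
End Transfer.

Section Deviation.
Context {R : realFieldType} {I : finType} (p w : R).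

Lemma bernE_chebyshev (E : pred {set I}) : 0 <= p <= 1 -> 0 < w ->
  (forall S, E S -> w ^+ 2 <= (#|S|%:R - #|I|%:R * p) ^+ 2) ->
  bernE p (enum I) (fun S => (E S)%:R) <= #|I|%:R * p / w ^+ 2.
Proof.
move=> p01 w0 Ew; have /andP[p0 p1] := p01.
have w20 : 0 < w ^+ 2 by rewrite exprn_gt0.
rewrite ler_pdivlMr// mulrC -bernEZ.
apply: le_trans (_ : bernE p (enum I) (fun S => (#|S|%:R - (size (enum I))%:R * p) ^+ 2) <= _).
  apply: bernE_le => // S _; rewrite -cardE; case ES: (E S); rewrite ?mulr1 ?mulr0 ?sqr_ge0//.
  exact: Ew.
rewrite bernE_card_variance ?enum_uniq// -cardE.
by rewrite -[leRHS]mulr1 ler_wpM2l ?mulr_ge0// gerBl.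
Qed.
End Deviation.

(** * Random 2-SAT formulas as draws *)

Section Link.
Context {n : nat}.
Implicit Types (c : clause 2 n) (L : {set literal n}) (S : {set {set literal n}}).

Definition clause_lits c : {set literal n} := [set l in val (val c)].

Lemma clause_destruct c : exists a b : literal n,
  (val a.1 < val b.1)%N /\ val (val c) = [:: a; b].
Proof.
case: c => [[[|a [|b []]] sz] srt] //=; exists a, b; split=> //.
by move: srt; rewrite /= andbT.
Qed.

Lemma clause_evalE c x : clause_eval c x = [exists l in clause_lits c, lit_eval l x].
Proof.
apply/existsP/exists_inP => [[i ci]|[l + lx]].
  by exists (tnth (val c) i); rewrite // inE mem_tnth.
by rewrite inE => /(tnthP (val c))[i li]; exists i; rewrite -li.
Qed.

Lemma clause_lits_inj : injective clause_lits.
Proof.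
move=> c c' /setP e; apply/val_inj/val_inj.
have [a [b [ab ce]]] := clause_destruct c.
have [a' [b' [ab' ce']]] := clause_destruct c'.
rewrite ce ce'; have {}e l : (l \in [:: a; b]) = (l \in [:: a'; b']).
  by have := e l; rewrite !in_set ce ce'.
have := e a; have := e b; rewrite !inE !eqxx ?orbT /= => /esym/orP[]/eqP hb /esym/orP[]/eqP ha.
- by move: ab; rewrite ha hb ltnn.
- by move: ab; rewrite ha hb ltnNge ltnW.
- by rewrite ha hb.
- by move: ab; rewrite ha hb ltnn.
Qed.

Lemma clause_lits_on c : clause_lits c \in clauses_on setT.
Proof.
have [a [b [ab ce]]] := clause_destruct c.
rewrite (_ : clause_lits c = [set a; b]) ?mem_clauses_on ?inE /=.
  by apply: contraTneq ab => ->; rewrite ltnn.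
by apply/setP => l; rewrite !inE ce !inE.
Qed.

Lemma clause_lits_onto C : C \in clauses_on setT -> exists c, clause_lits c = C.
Proof.
case/clauses_onP => a [b [_ _ + ->]].
wlog ab : a b / (val a.1 < val b.1)%N.
  move=> wl ab; have : val a.1 != val b.1 by [].
  rewrite neq_ltn => /orP[] lt; first exact: wl.
  have [|c e] := wl b a lt; first by rewrite eq_sym.
  by exists c; rewrite e setUC.
move=> _; have srt : sorted ltn [seq val (lit_var l) | l <- [tuple a; b]] by rewrite /= ab.
by exists (exist _ [tuple a; b] srt); apply/setP => l; rewrite !inE.
Qed.

(** Variables and signs of a clause can be chosen separately. *)
Lemma card_clause : #|clause 2 n| = (2 * (n * n.-1))%N.
Proof.
pose f (t : 2.-tuple (literal n)) : 2.-tuple 'I_n * 2.-tuple bool :=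
  (map_tuple (fun l : literal n => l.1) t, map_tuple (fun l : literal n => l.2) t).
have finj : injective f.
  move=> t u [e1 e2]; apply/val_inj => /=.
  by rewrite -(zip_unzip (tval t)) -(zip_unzip (tval u)) /unzip1 /unzip2 e1 e2.
rewrite card_sig -(card_imset _ finj).
rewrite (_ : #|_| = #|setX [set t : 2.-tuple 'I_n | sorted ltn [seq val i | i <- t]] [set: 2.-tuple bool]|).
  rewrite cardsX card_ltn_sorted_tuples cardsT card_tuple card_bool.
  have := bin_ffact n 2; rewrite ffactnS ffactn1 => <-.
  by rewrite (_ : 2`! = 2%N)// mulnCA mulnC.
apply: eq_card => -[t u]; rewrite !inE andbT /=.
apply/imsetP/idP => [[v vs [-> _]]|ts].
  by rewrite inE in vs; rewrite /= -map_comp.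
exists [tuple of zip t u].
  rewrite inE (_ : [seq _ | l <- _] = [seq val i | i <- t])//.
  rewrite (map_comp (fun i : 'I_n => val i) (fun l : literal n => l.1)) /=.
  by rewrite -/(unzip1 _) unzip1_zip// !size_tuple.
congr (_, _); apply/val_inj => /=.
  by rewrite -/(unzip1 _) unzip1_zip// !size_tuple.
by rewrite -/(unzip2 _) unzip2_zip// !size_tuple.
Qed.

Lemma bernE_clauses (R : realFieldType) (p : R) (F : {set {set literal n}} -> R) :
  bernE p (enum (clauses_on setT)) F =
  bernE p (enum (clause 2 n)) (fun T => F [set clause_lits c | c in T]).
Proof.
rewrite -bernE_map; apply: bernE_perm; apply: uniq_perm.
- exact: enum_uniq.
- by rewrite map_inj_uniq ?enum_uniq//; exact: clause_lits_inj.
move=> C; rewrite mem_enum; apply/idP/mapP => [/clause_lits_onto[c <-]|[c _ ->]].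
  by exists c; rewrite ?mem_enum.
exact: clause_lits_on.
Qed.

Definition formula_clauses m (phi : formula 2 n m) : {set {set literal n}} :=
  [set clause_lits c | c in image_set phi].

Lemma formula_evalE m (phi : formula 2 n m) x :
  formula_eval phi x = [forall C in formula_clauses phi, [exists l in C, lit_eval l x]].
Proof.
apply/forallP/forall_inP => [H C /imsetP[c /imsetP[j _ ->] ->]|H j].
  by rewrite -clause_evalE.
by rewrite clause_evalE; apply: H; apply: imset_f; apply: imset_f.
Qed.

Lemma satisfiable_sat_with m (phi : formula 2 n m) :
  satisfiable (formula_eval phi) = sat_with set0 (formula_clauses phi).
Proof.
apply: eq_existsb => x; rewrite formula_evalE; apply/esym/andb_idl => _.
by apply/forall_inP => l; rewrite inE.
Qed.

Lemma satisfiable_fix_vars m (phi : formula 2 n m) L : consistent L ->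
  satisfiable (fix_vars L (formula_eval phi)) = sat_with L (formula_clauses phi).
Proof.
move=> cL; apply/existsP/existsP => -[x].
  rewrite /fix_vars formula_evalE => H; exists (fix_assignment L x); rewrite H andbT.
  apply/forall_inP => -[v s] vL; rewrite /lit_eval /lit_var /= ffunE; case: s vL => vL.
    by rewrite vL.
  by have := cL _ vL; rewrite /lit_neg /= => /negPf ->; rewrite vL.
move=> /andP[/forall_inP xL H]; exists x; rewrite /fix_vars.
rewrite (_ : fix_assignment L x = x) ?formula_evalE//; apply/ffunP => v; rewrite ffunE.
case: ifP => [/xL|_]; first by rewrite /lit_eval /= => ->.
by case: ifP => // /xL; rewrite /lit_eval /= => /negPf ->.
Qed.

Lemma formula_prob_drawE (R : realType) m (E : pred (formula 2 n m))
    (F : pred {set {set literal n}}) :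
  (forall phi, E phi = F (formula_clauses phi)) ->
  formula_prob R E = drawE m (fun T => (F [set clause_lits c | c in T])%:R).
Proof.
move=> EF; rewrite /formula_prob /drawE mulr_sumr [LHS]big_mkcond /=; apply: eq_bigr => phi _.
rewrite -/(formula_clauses phi) -EF /formula_law prodr_const card_ord /clause_law exprVn.
by case: (E phi); rewrite ?mulr1 ?mulr0.
Qed.

Lemma num_clauses1 (R : realType) : num_clauses (1 : R) n = n.
Proof. by rewrite /num_clauses mul1r natrK. Qed.

Definition drawn_sat (R : realType) L : R :=
  drawE n (fun T : {set clause 2 n} => (sat_with L [set clause_lits c | c in T])%:R).

Lemma sat_probE (R : realType) : sat_prob 2 (1 : R) n = drawn_sat R set0.
Proof.
rewrite /sat_prob (formula_prob_drawE _ (F := sat_with set0)) ?num_clauses1//.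
exact: satisfiable_sat_with.
Qed.

Lemma sat_prob_fixedE (R : realType) L : consistent L ->
  sat_prob_fixed 2 (1 : R) L = drawn_sat R L.
Proof.
move=> cL; rewrite /sat_prob_fixed (formula_prob_drawE _ (F := sat_with L)) ?num_clauses1//.
by move=> phi; exact: satisfiable_fix_vars.
Qed.

Lemma drawn_sat_ge0 (R : realType) L : 0 <= drawn_sat R L.
Proof. by rewrite mulr_ge0 ?invr_ge0 ?exprn_ge0// sumr_ge0. Qed.

Lemma drawn_sat_anti (R : realType) L (L' : {set literal n}) : L' \subset L ->
  drawn_sat R L <= drawn_sat R L'.
Proof.
move=> L'L; apply: drawE_le => phi; rewrite ler_nat.
by case sL : (sat_with L _) => //; rewrite (sat_withS L'L _ sL).
Qed.
End Link.

Section Compare.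
Context {R : realType} {n : nat}.
Variable Ev : {set {set literal n}} -> bool.
Hypothesis n2 : (2 <= n)%N.
Hypothesis Eanti : forall S S' : {set {set literal n}}, S \subset S' -> Ev S' -> Ev S.

Let h (T : {set clause 2 n}) : R := (Ev [set clause_lits c | c in T])%:R.

Let I0 : (0 < #|clause 2 n|)%N.
Proof. by rewrite card_clause; case: n n2 => [|[|k]]. Qed.

Let h01 T : 0 <= h T <= 1.
Proof. by rewrite /h; case: (Ev _); rewrite lexx ler01. Qed.

Let hanti (T T' : {set clause 2 n}) : T \subset T' -> h T' <= h T.
Proof.
move=> TT'; rewrite /h ler_nat; case E: (Ev [set _ | c in T']) => //.
by rewrite lt0b; apply: Eanti E; exact: imsetS.
Qed.

(** With [w] more clauses expected than drawn, fewer than [n] clauses are present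
only with the Chebyshev probability [(n + w) / w ^+ 2]. *)
Lemma drawn_ge (p w : R) : 0 <= p <= 1 -> 0 < w ->
  2 * (n%:R * (n%:R - 1)) * p = n%:R + w ->
  bernE p (enum (clauses_on [set: 'I_n])) (fun S => (Ev S)%:R)
    <= (n%:R + w) / w ^+ 2 + drawE n h.
Proof.
move=> p01 w0 e; rewrite bernE_clauses; apply: le_trans (bernE_le_drawE n I0 h01 hanti p01) _.
have eM : #|clause 2 n|%:R * p = n%:R + w.
  rewrite -e card_clause !natrM; congr (2 * (_ * _) * _).
  by rewrite -subn1 natrB// ltnW.
rewrite lerD2r -eM.
apply: (bernE_chebyshev (E := fun S => (#|S| < n)%N)) => // S Sn.
rewrite eM; have : #|S|%:R <= n%:R :> R by rewrite ler_nat ltnW.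
by rewrite !expr2; nra.
Qed.

(** The margin [2 * w] is shared: at most [w] draws are lost to collisions, and the
number of present clauses exceeds its mean by at most [w]. *)
Lemma drawn_le (p w : R) : 0 <= p <= 1 -> 0 < w ->
  2 * (n%:R * (n%:R - 1)) * p = n%:R - 2 * w ->
  drawE n h * (1 - (n%:R - 2 * w) / w ^+ 2) <=
  n%:R / (2 * (n%:R - 1)) / w +
  bernE p (enum (clauses_on [set: 'I_n])) (fun S => (Ev S)%:R).
Proof.
move=> p01 w0 e; have n0 : 0 < n%:R :> R by rewrite ltr0n ltnW.
have n1 : 0 < n%:R - 1 :> R by rewrite subr_gt0 ltr1n.
have eM' : #|clause 2 n|%:R = 2 * (n%:R * (n%:R - 1)) :> R.
  by rewrite card_clause !natrM; congr (2 * (_ * _)); rewrite -subn1 natrB// ltnW.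
have eM : #|clause 2 n|%:R * p = n%:R - 2 * w by rewrite eM'.
have h0 : 0 <= drawE n h.
  rewrite -[leLHS](@drawE_cst R _ n I0); apply: drawE_le => phi.
  by case/andP: (h01 (image_set phi)).
rewrite bernE_clauses; apply: le_trans (_ : drawE n h *
    bernE p (enum (clause 2 n)) (fun S => (#|S|%:R <= n%:R - w)%R%:R) <= _).
  rewrite ler_wpM2l//.
  pose E (S : {set clause 2 n}) := n%:R - w < #|S|%:R :> R.
  have ED : bernE p (enum (clause 2 n)) (fun S => (#|S|%:R <= n%:R - w)%R%:R) +
      bernE p (enum (clause 2 n)) (fun S => (E S)%:R) = 1.
    rewrite -bernED -[RHS](bernE_cst p (enum (clause 2 n))); apply: eq_bernE => S.
    by rewrite /E leNgt; case: (_ < _); rewrite /= ?addr0 ?add0r.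
  have : bernE p (enum (clause 2 n)) (fun S => (E S)%:R) <= (n%:R - 2 * w) / w ^+ 2.
    rewrite -eM; apply: (bernE_chebyshev (E := E)) => // S.
    by rewrite eM /E !expr2; nra.
  by move: ED; lra.
apply: le_trans (drawE_le_bernE n I0 h01 hanti _ p01) _.
rewrite lerD2r; apply: le_trans (drawE_few I0 _) _; first by rewrite gtrBl.
rewrite eM' (_ : n%:R - (n%:R - w) = w); last by ring.
rewrite le_eqVlt; apply/orP; left; apply/eqP; field.
by rewrite !gt_eqF.
Qed.
End Compare.

(** * Estimates at density one *)

Lemma sat_withS_anti n (L : {set literal n}) (S S' : {set {set literal n}}) :
  S \subset S' -> sat_with L S' -> sat_with L S.
Proof. by move=> SS'; exact: sat_withS. Qed.

Lemma autarkyS_anti n (L : {set literal n}) (S S' : {set {set literal n}}) :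
  S \subset S' -> autarky L S' -> autarky L S.
Proof. by move=> SS'; exact: autarkyS. Qed.

Section Window.
Context {R : realType}.

(** About [n + k ^+ 2 / 10] clauses are expected, where [k ^+ 3 = n]: the excess is
beyond the fluctuations, of order [k] to the power [3 / 2], yet changes the
density by only [1 / (10 * k)], which stays inside the critical window. *)
Definition window_p (n : nat) (k : R) : R :=
  (n%:R + k ^+ 2 / 10) / (2 * (n%:R * (n%:R - 1))).

Lemma window_pP n (k : R) : k ^+ 3 = n%:R -> 20 <= k ->
  let p := window_p n k in
  [/\ 0 <= p < 1, 2 * (n%:R * (n%:R - 1)) * p = n%:R + k ^+ 2 / 10,
      n%:R * p <= 2 / 3, 2 * (n%:R * p) <= 1 + 1 / (9 * k)
    & 2 * (n.+1%:R * p) <= 1 + 1 / (8 * k)].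
Proof.
move=> kn k20 p; have k0 : 0 < k by lra.
have k2 : 400 <= k ^+ 2 by rewrite expr2; nra.
have nE : n%:R = k * k ^+ 2 :> R by rewrite -kn exprS.
have nL : 20 * k ^+ 2 <= n%:R by rewrite nE ler_wpM2r//; lra.
have n0 : 0 < n%:R :> R by lra.
have n1 : 0 < n%:R - 1 :> R by lra.
have e : 2 * (n%:R * (n%:R - 1)) * p = n%:R + k ^+ 2 / 10.
  by rewrite /p /window_p; field; rewrite !gt_eqF.
have p0 : 0 <= p by apply: divr_ge0; [lra|rewrite !mulr_ge0// ltW].
have e' : (n%:R - 1) * (2 * (n%:R * p)) = n%:R + k ^+ 2 / 10 by rewrite -e; ring.
have np : n%:R * p <= 2 / 3.
  suff : 2 * (n%:R * p) <= 4 / 3 by lra.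
  by rewrite -(ler_pM2l n1) e'; lra.
have np9 : 2 * (n%:R * p) <= 1 + 1 / (9 * k).
  rewrite -(ler_pM2l n1) e' mulrDr mulr1.
  have -> : (n%:R - 1) * (1 / (9 * k)) = k ^+ 2 / 9 - 1 / (9 * k).
    by rewrite nE; field; rewrite gt_eqF.
  have : 1 / (9 * k) <= 1 by rewrite ler_pdivrMr ?mulr_gt0//; lra.
  lra.
have p80 : 2 * p <= 1 / (80 * k).
  rewrite ler_pdivlMr ?mulr_gt0// -(ler_pM2l n0).
  have : k * (n%:R * p) <= k * (2 / 3) by rewrite ler_wpM2l// ltW.
  have : k * 400 <= n%:R by rewrite nE ler_wpM2l// ltW.
  have -> : n%:R * (2 * p * (80 * k)) = 160 * (k * (n%:R * p)) by ring.
  lra.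
have inv : 1 / (9 * k) + 1 / (80 * k) <= 1 / (8 * k).
  have : 0 < k^-1 by rewrite invr_gt0.
  by rewrite !div1r !invfM; lra.
split=> //.
  rewrite p0 /=; have : 2 * p <= 1 / 4.
    by apply: le_trans p80 _; rewrite ler_pdivrMr ?mulr_gt0//; lra.
  lra.
by rewrite -natr1; lra.
Qed.

Lemma deviation_bound n (k : R) : k ^+ 3 = n%:R -> 20 <= k ->
  (n%:R + k ^+ 2 / 10) / (k ^+ 2 / 10) ^+ 2 <= 200 / k.
Proof.
move=> kn k20; have k0 : 0 < k by lra.
rewrite -kn [leLHS](_ : _ = (100 + 10 / k) / k); last by field; rewrite gt_eqF.
rewrite ler_pM2r ?invr_gt0//.
have : 10 / k <= 1 by rewrite ler_pdivrMr//; lra.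
lra.
Qed.

(** With fewer than [vs] variables left, about two [k ^+ 2] steps after the start,
the drift is at most [- 2 / k]. There bicycles are absent with probability at
least [1 / 2], and the steps before cost at most a constant factor. *)
Lemma critical_sat_lower n (k : R) : k ^+ 3 = n%:R -> 20 <= k ->
  1 / 2 * expR (- 110) - 200 / k <= drawn_sat R (set0 : {set literal n}).
Proof.
move=> kn k20; have k0 : 0 < k by lra.
have [p01 e np np9 _] := window_pP kn k20.
set p := window_p n k in p01 e np np9.
have p01' : 0 <= p <= 1 by case/andP: p01 => -> /ltW ->.
have /andP[p0 p1] := p01'.
have n2 : (2 <= n)%N.
  rewrite -(ler_nat R) -kn; apply: le_trans (_ : k ^+ 1 <= _); first by rewrite expr1; lra.
  by rewrite ler_eXn2l//; lra.
rewrite lerBlDl; have w0 : 0 < k ^+ 2 / 10 by rewrite divr_gt0// exprn_gt0.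
apply: le_trans (_ : (n%:R + k ^+ 2 / 10) / (k ^+ 2 / 10) ^+ 2 + drawn_sat R set0 <= _); last first.
  by apply: lerD; first exact: deviation_bound.
apply: le_trans (drawn_ge n2 (@sat_withS_anti n set0) p01' w0 e).
have ik : 0 < k^-1 <= 1 / 20.
  rewrite invr_gt0 k0/= -[leLHS]div1r ler_pdivrMr//; lra.
move: ik => /andP[i0 i20].
set i := k^-1 in i0 i20.
have ki : k * i = 1 by rewrite divff ?gt_eqF.
have p2 : 2 * (n%:R * p) <= 1 + i / 8.
  apply: le_trans np9 _; have -> : 1 / (9 * k) = i / 9 by rewrite /i; field; rewrite gt_eqF.
  lra.
have pi : k * k * p <= 2 / 3 * i.
  have -> : k * k * p = (n%:R * p) * i by rewrite -kn -[LHS]mulr1 -ki; ring.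
  by rewrite ler_wpM2r// ltW.
have pii : k * p <= 2 / 3 * (i * i).
  have -> : k * p = (k * k * p) * i by rewrite -[LHS]mulr1 -ki; ring.
  by rewrite mulrA ler_wpM2r// ltW.
have piii : p <= 2 / 3 * (i * i * i).
  have -> : p = (k * p) * i by rewrite -[LHS]mulr1 -ki; ring.
  by rewrite [leRHS](_ : _ = 2 / 3 * (i * i) * i) ?ler_wpM2r ?(ltW i0)//; ring.
pose d := 2 * i.
have d01 : 0 < d <= 1 by rewrite /d; lra.
have base (V : {set 'I_n}) : 2 * (#|V|%:R * p) <= 1 - d ->
    1 / 2 <= bernE p (enum (clauses_on V)) (fun S => (sat_with set0 S)%:R).
  move=> Vd; apply: le_trans (sat_with_empty_lower p01' d01 Vd).
  have -> : 6 * p / d ^+ 3 = 6 / 8 * (n%:R * p).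
    by rewrite /d /i -kn; field; rewrite gt_eqF.
  lra.
pose vs : R := n%:R * (1 - d - i / 8).
have n0 : 0 <= n%:R :> R by [].
have vs0 : 0 <= vs by rewrite mulr_ge0// /d; lra.
pose Q : R := n%:R - vs + 1.
have QE : Q = 17 / 8 * (k * k) + 1.
  by rewrite /Q /vs /d -kn /i; field; rewrite gt_eqF.
have kk1 : 1 <= k * k by nra.
have ii0 : 0 <= i * i by rewrite mulr_ge0// ltW.
have al : [/\ 0 <= 1 :> R, 0 <= 34 * (i * i), 0 <= i * i & 0 <= 2 * (i * i * (i * i))].
  by split; rewrite ?mulr_ge0// ltW.
have phase2 (V : {set 'I_n}) (A : {set literal n}) :
    A \subset lits V -> consistent A -> #|V|%:R <= vs ->
    1 / 2 * expR (- (1 + i * i * #|A|%:R ^+ 2)) <=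
    bernE p (enum (clauses_on V)) (fun S => (sat_with A S)%:R).
  move=> AV cA Vs.
  have Vd : 2 * (#|V|%:R * p) <= 1 - d.
    apply: le_trans (_ : 2 * (vs * p) <= _); first by rewrite ler_wpM2l// ler_wpM2r.
    have -> : 2 * (vs * p) = (2 * (n%:R * p)) * (1 - d - i / 8) by rewrite /vs; ring.
    apply: le_trans (_ : (1 + i / 8) * (1 - d - i / 8) <= _); first by rewrite ler_wpM2r// /d; lra.
    by rewrite /d; nra.
  apply: le_trans (sat_with_subcritical p01 np d01 base AV cA Vd).
  rewrite ler_wpM2l// ler_expR lerN2.
  set a := #|A|%:R; have a0 : 0 <= a by [].
  have -> : 3 * p / d ^+ 2 = 3 / 4 * (k * k * p) by rewrite /d /i; field; rewrite gt_eqF.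
  have -> : 3 * p / (2 * d) = 3 / 4 * (k * p) by rewrite /d /i; field; rewrite gt_eqF.
  have h1 : (k * k * p) * a <= 2 / 3 * i * a by rewrite ler_wpM2r.
  have h2 : (k * p) * a ^+ 2 <= 2 / 3 * (i * i) * a ^+ 2 by rewrite ler_wpM2r// sqr_ge0.
  have : 0 <= (1 - i * a) ^+ 2 by rewrite sqr_ge0.
  rewrite !expr2 in h2 *; nra.
have iiQ : i * i * (i * i) * Q <= 3 * (i * i).
  have -> : i * i * (i * i) * Q = i * i * (17 / 8 * (k * i) * (k * i) + i * i) by rewrite QE; ring.
  by rewrite ki mulrC ler_wpM2r//; nra.
have drift (a : R) : 1 <= a ->
    3 * (a * p) + (i * i + 2 * (i * i * (i * i)) * Q) * (2 * (i / 8) * a + 4)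
    <= 34 * (i * i) + 2 * (i * i * (i * i)) * a ^+ 2.
  move=> a1; have ia0 : 0 <= i * a by rewrite mulr_ge0//; lra.
  have h1 : a * p <= a * (2 / 3 * (i * i * i)) by rewrite ler_wpM2l//; lra.
  have h2 : (i * i + 2 * (i * i * (i * i)) * Q) * (2 * (i / 8) * a + 4) <=
      (7 * (i * i)) * (2 * (i / 8) * a + 4).
    by rewrite ler_wpM2r//; lra.
  have h3 : 0 <= (i * i) * (1 - i * a) ^+ 2 by rewrite mulr_ge0 ?sqr_ge0.
  have -> : a ^+ 2 = a * a by rewrite expr2.
  rewrite expr2 in h3; have h4 : 0 <= (i * i) * (i * a * (i * a)).
    by rewrite mulr_ge0// mulr_ge0.
  lra.
have d0 : 0 <= i / 8 <= 1 / 2 by lra.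
have := @sat_with_window R n p (i / 8) vs Q 1 (34 * (i * i)) (i * i) (2 * (i * i * (i * i)))
   p01 np vs0 p2 d0 al phase2 drift setT set0 Q.
rewrite cards0 => h; apply: le_trans (h _ _ _ _).
- rewrite ler_wpM2l// ler_expR lerN2 (_ : maxn 0 1 = 1%N)// expr1n mulr1.
  have : i * i * Q <= 3.
    have -> : i * i * Q = 17 / 8 * (k * i) * (k * i) + i * i by rewrite QE; ring.
    by rewrite ki; nra.
  have : i * i <= 1 by nra.
  lra.
- exact: sub0set.
- by move=> l; rewrite inE.
- by rewrite lexx andbT QE; lra.
- by right; rewrite cardsT card_ord /Q; lra.
Qed.

(** Unsatisfiability caused by fixing [L] requires a conflict of the propagation
from [L]; the bound of [autarky_lower] is used with [z = (k * s)^-1], which makes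
both of its error terms at most of order [s]. *)
Lemma drawn_fix_few n (k s : R) (L : {set literal n}) :
  k ^+ 3 = n%:R -> 20 <= k -> consistent L -> 0 < s <= 1 ->
  1 <= k * s ^+ 2 -> #|L|%:R <= k * s ^+ 2 ->
  drawn_sat R (set0 : {set literal n}) <= drawn_sat R L + 209 * s.
Proof.
move=> kn k20 cL /andP[s0 s1] ks1 Ls; have k0 : 0 < k by lra.
have [p01 e np _ np8] := window_pP kn k20.
set p := window_p n k in p01 e np np8.
have p01' : 0 <= p <= 1 by case/andP: p01 => -> /ltW ->.
have /andP[p0 p1] := p01'.
have n2 : (2 <= n)%N.
  rewrite -(ler_nat R) -kn; apply: le_trans (_ : k ^+ 1 <= _); first by rewrite expr1; lra.
  by rewrite ler_eXn2l//; lra.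
have I0 : (0 < #|clause 2 n|)%N.
  rewrite card_clause muln_gt0/= muln_gt0; apply/andP; split; first exact: ltnW.
  by rewrite -ltnS prednK// ltnW.
have w0 : 0 < k ^+ 2 / 10 by rewrite divr_gt0// exprn_gt0.
pose z := (k * s)^-1.
have ks0 : 0 < k * s by rewrite mulr_gt0.
have z0 : 0 < z by rewrite invr_gt0.
have ks2 : 2 <= k * s.
  have : 20 <= (k * s) * (k * s).
    have -> : (k * s) * (k * s) = k * (k * s ^+ 2) by ring.
    by rewrite -[leLHS]mulr1; apply: ler_pM => //; lra.
  by move=> H; rewrite leNgt; apply/negP => lt; move: H; nra.
have z1 : z <= 1 / 2 by rewrite /z -[leLHS]div1r ler_pdivrMr//; lra.
have pz : 2 * (n.+1%:R * p) <= 1 + z / 8.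
  apply: le_trans np8 _; rewrite lerD2l.
  have -> : 1 / (8 * k) = k^-1 / 8 by field; rewrite gt_eqF.
  rewrite ler_pM2r ?invr_gt0// /z lef_pV2 ?posrE// -[leRHS]mulr1.
  by rewrite ler_wpM2l// ltW.
have LT : L \subset lits setT by apply/fintype.subsetP => l _; rewrite !inE.
have low := le_trans (autarky_lower p01 z0 z1 pz LT cL)
  (drawn_ge n2 (@autarkyS_anti n L) p01' w0 e).
have low2 := deviation_bound kn k20.
have low3 : 1 - s <= (1 - z) ^+ #|L|.
  have z01 : 0 <= z <= 1 by lra.
  apply: le_trans (pow1B_ge #|L| z01); rewrite lerD2l lerN2.
  by rewrite /z ler_pdivrMr// mulrCA -expr2.
have low4 : 8 * p / z ^+ 3 <= 8 * s.
  have -> : 8 * p / z ^+ 3 = 8 * s * (n%:R * p * (s * s)).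
    by rewrite /z -kn; field; rewrite !gt_eqF.
  rewrite -[leRHS]mulr1 ler_wpM2l ?mulr_ge0 ?(ltW s0)//.
  have np1 : n%:R * p <= 1 by lra.
  have ss : s * s <= 1 by rewrite mulr_ile1// ltW.
  by apply: mulr_ile1 => //; rewrite mulr_ge0// ltW.
have low5 : 200 / k <= 200 * s.
  rewrite ler_pdivrMr//; have : k * s ^+ 2 <= k * s by rewrite ler_wpM2l ?(ltW k0)// expr2 ger_pMr.
  lra.
set dA := drawE n _ in low.
have : drawn_sat R (set0 : {set literal n}) <= drawn_sat R L + (1 - dA).
  rewrite -(@drawE_cst R _ n I0 1) /drawn_sat /dA.
  pose a (T : {set clause 2 n}) : R := (sat_with L [set clause_lits c | c in T])%:R.
  pose b (T : {set clause 2 n}) : R := (autarky L [set clause_lits c | c in T])%:R.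
  rewrite -[X in _ <= _ + (_ - X)]/(drawE n b) -[X in _ <= X + _]/(drawE n a).
  have -> : drawE n a + (drawE n (fun _ : {set clause 2 n} => 1) - drawE n b) =
      drawE n (fun T => 1 * a T + 1 * (1 * 1 + (-1) * b T)).
    by rewrite (drawE_linear n a (fun T => 1 * 1 + (-1) * b T)) (drawE_linear n (fun=> 1) b); ring.
  rewrite /a /b.
  apply: drawE_le => phi; set S := [set _ | _ in _].
  rewrite !mul1r mulN1r; case: (boolP (autarky L S)) => [aL|_].
    rewrite subrr addr0 ler_nat; case s0S : (sat_with set0 S) => //.
    by rewrite (autarky_sat_with aL s0S).
  rewrite subr0; apply: (@le_trans _ _ 1); last by rewrite lerDr ler0n.
  by rewrite lern1 leq_b1.
lra.
Qed.

(** After [k ^+ 2] steps the drift is still at least [- 5 / k], so the queue loses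
only order [k] literals, while the conflict probabilities add up to order
[f / k]. Here the Bernoulli model has [2 * k ^+ 2] clauses less than [n]. *)
Lemma drawn_fix_many n (k : R) (f : nat) (L : {set literal n}) :
  k ^+ 3 = n%:R -> 20 <= k -> consistent L -> (f <= #|L|)%N ->
  k <= f%:R -> f%:R <= k ^+ 2 / 2 ->
  drawn_sat R L <= 146 * (k / f%:R).
Proof.
move=> kn k20 cL fL kf fk; have k0 : 0 < k by lra.
have [L' L'L cardL'] : exists2 L' : {set literal n}, L' \subset L & #|L'| = f.
  exists [set l in take f (enum L)].
    by apply/fintype.subsetP => l; rewrite inE => /mem_take; rewrite mem_enum.
  rewrite cardsE; have /card_uniqP -> : uniq (take f (enum L)) by rewrite take_uniq// enum_uniq.
  by rewrite size_takel// -cardE.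
have cL' : consistent L'.
  move=> l lL'; apply: contra (cL l (fintype.subsetP L'L _ lL')).
  exact: fintype.subsetP.
apply: le_trans (_ : drawn_sat R L' <= _).
  exact: drawn_sat_anti.
have k2 : 400 <= k ^+ 2 by rewrite expr2; nra.
have nE : n%:R = k * k ^+ 2 :> R by rewrite -kn exprS.
have nL : 20 * k ^+ 2 <= n%:R by rewrite nE ler_wpM2r//; lra.
have n0 : 0 < n%:R :> R by lra.
have n1 : 0 < n%:R - 1 :> R by lra.
have n2 : (2 <= n)%N by rewrite -(ler_nat R); lra.
have f0 : 0 < f%:R :> R by lra.
pose p : R := (n%:R - 2 * k ^+ 2) / (2 * (n%:R * (n%:R - 1))).
have e : 2 * (n%:R * (n%:R - 1)) * p = n%:R - 2 * k ^+ 2.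
  by rewrite /p; field; rewrite !gt_eqF.
have p0 : 0 <= p by apply: divr_ge0; [lra|rewrite !mulr_ge0// ltW].
clearbody p.
have e' : (n%:R - 1) * (2 * (n%:R * p)) = n%:R - 2 * k ^+ 2 by rewrite -e; ring.
have np1 : 2 * (n%:R * p) <= 1 by rewrite -(ler_pM2l n1) e'; lra.
have ki : k * k^-1 = 1 by rewrite divff ?gt_eqF.
have i0 : 0 < k^-1 by rewrite invr_gt0.
have i20 : k^-1 <= 1 / 20 by rewrite -[leLHS]div1r ler_pdivrMr//; lra.
have np2 : 1 - 2 * k^-1 <= 2 * (n%:R * p).
  rewrite -(ler_pM2l n1) e'.
  have -> : (n%:R - 1) * (1 - 2 * k^-1) = n%:R - 2 * k ^+ 2 * (k * k^-1) - 1 + 2 * k^-1.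
    by rewrite nE; ring.
  by rewrite ki; lra.
have pi : p <= k^-1.
  rewrite -(ler_pM2l n0); have : 1 <= n%:R * k^-1.
    by rewrite nE mulrAC ki mul1r; lra.
  lra.
have p01 : 0 <= p < 1 by rewrite p0 /=; lra.
have p01' : 0 <= p <= 1 by rewrite p0 /=; lra.
have w0 : 0 < k ^+ 2 by lra.
have d01 : 0 <= 5 * k^-1 <= 1 by lra.
have ur (u : nat) : n%:R - k ^+ 2 - 3 / 2 * f%:R <= u%:R ->
    1 - 5 * k^-1 <= u%:R * (2 * p / (1 + p)).
  move=> hu; have [_ _ _ r2] := binE_rate p01'.
  have hu2 : n%:R * (1 - 2 * k^-1) <= u%:R.
    have -> : n%:R * (1 - 2 * k^-1) = n%:R - 2 * k ^+ 2 * (k * k^-1) by rewrite nE; ring.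
    apply: le_trans hu.
    by rewrite ki; lra.
  apply: le_trans (_ : u%:R * (2 * p * (1 - p)) <= _); last by rewrite ler_wpM2l.
  have p1 : p <= 1 by lra.
  have q0 : 0 <= 2 * p * (1 - p) by rewrite !mulr_ge0// subr_ge0.
  apply: le_trans (_ : n%:R * (1 - 2 * k^-1) * (2 * p * (1 - p)) <= _); last by rewrite ler_wpM2r.
  have -> : n%:R * (1 - 2 * k^-1) * (2 * p * (1 - p)) =
    (2 * (n%:R * p)) * (1 - 2 * k^-1) * (1 - p) by ring.
  apply: le_trans (_ : (1 - 2 * k^-1) * (1 - 2 * k^-1) * (1 - k^-1) <= _).
    by set i := k^-1 in i0 i20 *; nra.
  apply: ler_pM; [by rewrite mulr_ge0//; lra|lra| |lra].
  by rewrite ler_wpM2r//; lra.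
have f2 : 2 <= f%:R :> R by lra.
have LT : L' \subset lits setT by apply/fintype.subsetP => l _; rewrite !inE.
have /= up := @sat_with_upper R n p f%:R (5 * k^-1) (n%:R - k ^+ 2)
  p01 np1 f2 d01 ur setT L' LT cL'.
rewrite cardsT card_ord cardL' subrr expr0n add0r in up.
have qE : n%:R - (n%:R - k ^+ 2) + 1 = k ^+ 2 + 1 by ring.
rewrite qE in up; have {}up := up (ltr_wpDl (ltW w0) ltr01).
have dl := drawn_le n2 (@sat_withS_anti n L') p01' w0 e.
rewrite -/(drawn_sat R L') in dl.
set D := drawn_sat R L' in dl *.
have D0 : 0 <= D by exact: drawn_sat_ge0.
set y := k / f%:R.
have y0 : 0 < y by rewrite divr_gt0.
have y1 : y <= 1 by rewrite ler_pdivrMr// mul1r.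
have ye : k^-1 <= y.
  rewrite /y ler_pdivlMr// mulrC ler_pdivrMr//; rewrite -expr2; lra.
have t1 : 4 / f%:R ^+ 2 * ((f%:R * (5 * k^-1) + 2) * (k ^+ 2 + 1)) <= 56 * y.
  apply: le_trans (_ : 4 / f%:R ^+ 2 * ((f%:R * (5 * k^-1) + 2) * (2 * k ^+ 2)) <= _).
    rewrite ler_wpM2l ?divr_ge0 ?exprn_ge0//.
    rewrite ler_wpM2l//; last by lra.
    by rewrite addr_ge0// mulr_ge0//; lra.
  have -> : 4 / f%:R ^+ 2 * ((f%:R * (5 * k^-1) + 2) * (2 * k ^+ 2)) = 40 * y + 16 * (y * y).
    by rewrite /y; field; rewrite !gt_eqF.
  have : y * y <= y * 1 by rewrite ler_wpM2l// ltW.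
  lra.
have t2 : expR (- (p * (f%:R / 2 - 1) * (k ^+ 2 + 1 - 1))) <= 16 * y.
  have x1 : y^-1 / 16 <= p * (f%:R / 2 - 1) * (k ^+ 2 + 1 - 1).
    apply: le_trans (_ : p * (f%:R / 4) * k ^+ 2 <= _); last first.
      rewrite addrK ler_wpM2r ?(ltW w0)// ler_wpM2l//; lra.
    have -> : p * (f%:R / 4) * k ^+ 2 = (2 * (n%:R * p)) * y^-1 / 8.
      by rewrite /y nE; field; rewrite !gt_eqF.
    have : 1 / 2 * y^-1 <= (2 * (n%:R * p)) * y^-1.
      by rewrite ler_wpM2r ?invr_ge0 ?(ltW y0)//; lra.
    lra.
  apply: le_trans (_ : expR (- (y^-1 / 16)) <= _); first by rewrite ler_expR lerN2.
  rewrite expRN -[leLHS]div1r ler_pdivrMr ?expR_gt0//.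
  have h := expR_ge1Dx (y^-1 / 16).
  apply: le_trans (_ : 16 * y * (1 + y^-1 / 16) <= _); last first.
    by rewrite ler_wpM2l// mulr_ge0// ltW.
  have -> : 16 * y * (1 + y^-1 / 16) = 16 * y + 1 by field; rewrite gt_eqF.
  lra.
have t3 : (n%:R - 2 * k ^+ 2) / (k ^+ 2) ^+ 2 <= 1 / 2.
  rewrite -kn (_ : _ / _ = k^-1 - 2 * (k^-1 * k^-1)); last by field; rewrite gt_eqF.
  have : 0 <= k^-1 * k^-1 by rewrite mulr_ge0// ltW.
  lra.
have t4 : n%:R / (2 * (n%:R - 1)) / k ^+ 2 <= y.
  apply: le_trans ye; rewrite ler_pdivrMr// (_ : k^-1 * k ^+ 2 = k); last by field; rewrite gt_eqF.
  rewrite ler_pdivrMr ?mulr_gt0//; nra.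
have : D * (1 / 2) <= 73 * y.
  apply: le_trans (_ : D * (1 - (n%:R - 2 * k ^+ 2) / (k ^+ 2) ^+ 2) <= _).
    by rewrite ler_wpM2l//; lra.
  lra.
lra.
Qed.
End Window.

(** * Limits *)

Local Open Scope classical_set_scope.
Local Open Scope ring_scope.

Section Limits.
Context {R : realType}.

Definition cbrt (n : nat) : R := n%:R `^ (3%:R^-1).

Lemma cbrtK n : cbrt n ^+ 3 = n%:R.
Proof. by rewrite -powR_mulrn ?powR_ge0// -powRrM mulVf// powRr1. Qed.

Lemma near_cbrt_ge (c : R) : \forall n \near \oo, c <= cbrt n.
Proof.
near=> n; rewrite leNgt; apply/negP => lt.
have : cbrt n ^+ 3 < c ^+ 3.
  by apply: ltrXn2r => //; rewrite powR_ge0.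
rewrite cbrtK ltNge => /negP; apply.
by near: n; exact: nbhs_infty_ger.
Unshelve. all: by end_near. Qed.

Lemma near_powR_ge (e c : R) : 0 < e -> \forall n \near \oo, c <= n%:R `^ e.
Proof.
move=> e0; have [c0|c0] := leP c 0.
  by near=> n; rewrite (le_trans c0)// powR_ge0.
near=> n; have -> : c = (c `^ e^-1) `^ e.
  by rewrite -powRrM mulVf ?gt_eqF// powRr1// ltW.
apply: ge0_ler_powR; rewrite ?nnegrE ?powR_ge0 ?(ltW e0)//.
by near: n; exact: nbhs_infty_ger.
Unshelve. all: by end_near. Qed.

Lemma le_limn_einf_near (u v : nat -> \bar R) :
  (\forall n \near \oo, (u n <= v n)%E) -> (limn_einf u <= limn_einf v)%E.
Proof.
move=> [N _ uv]; rewrite !limn_einf_lim; apply: lee_lim; try exact: is_cvg_einfs.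
near=> n; apply: le_ereal_inf_tmp => _ [m /= nm <-].
apply: (@le_trans _ _ (u m)); first by apply: ereal_inf_lbound; exists m.
apply: uv => /=; apply: leq_trans nm.
by near: n; exists N.
Unshelve. all: by end_near. Qed.

Lemma limn_einf_eq (a b : nat -> R) :
  (forall n, a n <= b n) ->
  (forall d, 0 < d -> \forall n \near \oo, b n <= a n + d) ->
  limn_einf (fun n => (a n)%:E) = limn_einf (fun n => (b n)%:E).
Proof.
move=> ab ba; apply/eqP; rewrite eq_le; apply/andP; split.
  by apply: le_limn_einf_near; near=> n; rewrite lee_fin.
apply/lee_addgt0Pr => d d0; rewrite addeC -limn_einf_shift//.
apply: le_limn_einf_near; near=> n; rewrite -EFinD lee_fin addrC.
by near: n; exact: ba.
Unshelve. all: by end_near. Qed.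

Lemma limn_einf_ge (a : nat -> R) (c : R) : (\forall n \near \oo, c <= a n) ->
  (c%:E <= limn_einf (fun n => (a n)%:E))%E.
Proof.
move=> ca; have <- : limn_einf (fun=> c%:E) = c%:E.
  rewrite is_cvg_limn_einfE; last exact: is_cvg_cst.
  exact: lim_cst.
by apply: le_limn_einf_near; near=> n; rewrite lee_fin; near: n.
Unshelve. all: by end_near. Qed.
End Limits.

Theorem theorem2 (R : realType) :
  weak_degrees_of_freedom 2 (1 : R) (fun n : nat => n%:R `^ (3%:R^-1)).
Proof.
move=> f L cL cardL eps eps0.
have LE : forall n, sat_prob_fixed 2 (1 : R) (L n) = drawn_sat R (L n).
  by move=> n; exact: sat_prob_fixedE.
have SE : forall n, sat_prob 2 (1 : R) n = drawn_sat R (set0 : {set literal n}).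
  by move=> n; exact: sat_probE.
split=> [/eqO_exP[C C0 fO]|].
  split; last first.
    pose c : R := 1 / 2 * expR (- 110).
    have c0 : 0 < c by rewrite mulr_gt0 ?expR_gt0//; lra.
    apply: (@lt_le_trans _ _ (c / 2)%:E); first by rewrite lte_fin divr_gt0.
    apply: limn_einf_ge; near=> n.
    have k20 : 20 <= cbrt n :> R by near: n; exact: near_cbrt_ge.
    have kc : 400 / c <= cbrt n :> R by near: n; exact: near_cbrt_ge.
    have k0 : 0 < cbrt n :> R by lra.
    rewrite SE; apply: le_trans (critical_sat_lower (cbrtK n) k20).
    have : 200 / cbrt n <= c / 2.
      by rewrite ler_pdivrMr//; move: kc; rewrite ler_pdivrMr//; lra.
    rewrite -/c; lra.
  apply: limn_einf_eq => [n|d d0].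
    by rewrite LE SE drawn_sat_anti// sub0set.
  (* A fixed [s] suffices, because [f n / cbrt n] tends to [0]. *)
  pose s : R := Num.min 1 (d / 209).
  have s0 : 0 < s by rewrite lt_min ltr01 divr_gt0//; lra.
  have s1 : s <= 1 by rewrite ge_min lexx.
  have sd : 209 * s <= d.
    have : s <= d / 209 by rewrite ge_min lexx orbT.
    lra.
  have s20 : 0 < s ^+ 2 by rewrite exprn_gt0.
  near=> n.
  have k20 : 20 <= cbrt n :> R by near: n; exact: near_cbrt_ge.
  have ks : 1 <= cbrt n * s ^+ 2.
    rewrite -ler_pdivrMr//; near: n; exact: near_cbrt_ge.
  have fk : (f n)%:R <= C * `|cbrt n * n%:R `^ (- eps)|.
    by rewrite -[leLHS]ger0_norm//; near: n; exact: fO.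
  have ne : C / s ^+ 2 <= n%:R `^ eps by near: n; exact: near_powR_ge.
  rewrite LE SE; apply: le_trans (_ : drawn_sat R (L n) + 209 * s <= _); last by rewrite lerD2l.
  apply: (drawn_fix_few (cbrtK n)) => //; first by rewrite s0.
  rewrite cardL; apply: le_trans fk _.
  have k0 : 0 < cbrt n :> R by lra.
  have n0 : 0 < n%:R `^ eps :> R by apply: lt_le_trans ne; rewrite divr_gt0.
  rewrite ger0_norm ?mulr_ge0 ?powR_ge0 ?(ltW k0)// powRN mulrCA ler_wpM2l ?(ltW k0)//.
  by rewrite ler_pdivrMr// mulrC -ler_pdivrMr.
rewrite eqOmegaE eqOmegaO => /eqO_exP[C C0 fO].
apply/cvgr0Pnorm_le => d d0; near=> n.
pose B : R := Num.max 1 (146 / d).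
have B1 : 1 <= B by rewrite le_max lexx.
have Bd : 146 / d <= B by rewrite le_max lexx orbT.
have k20 : 20 <= cbrt n :> R by near: n; exact: near_cbrt_ge.
have kB : 4 * B <= cbrt n :> R by near: n; exact: near_cbrt_ge.
have nB : B * C <= n%:R `^ eps by near: n; exact: near_powR_ge.
have fk : `|cbrt n * n%:R `^ eps| <= C * `|(f n)%:R : R| by near: n; exact: fO.
have k0 : 0 < cbrt n :> R by lra.
have {}fk : B * cbrt n <= (f n)%:R.
  rewrite -(ler_pM2l C0); move: fk; rewrite !ger0_norm ?mulr_ge0 ?powR_ge0//.
  apply: le_trans; rewrite (_ : C * _ = cbrt n * (B * C)); last by ring.
  by rewrite ler_wpM2l// ltW.
(* Only [g] of the fixed literals are used, since [f n] may be as large as [n]. *)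
pose h := Num.truncn (cbrt n ^+ 2 / 2 : R).
have x0 : 0 <= cbrt n ^+ 2 / 2 :> R by rewrite divr_ge0// sqr_ge0.
have h1 : h%:R <= cbrt n ^+ 2 / 2 :> R by have /andP[] := truncn_itv x0.
have h2 : cbrt n ^+ 2 / 2 < h.+1%:R :> R by have /andP[] := truncn_itv x0.
pose g := minn (f n) h.
have hk : B * cbrt n <= h%:R.
  have : (4 * B) * cbrt n <= cbrt n ^+ 2 by rewrite expr2 ler_wpM2r// ltW.
  have : 20 * cbrt n <= cbrt n ^+ 2 :> R by rewrite expr2 ler_wpM2r// ltW.
  by move: h2; rewrite -[h.+1%:R]natr1; lra.
have gk : B * cbrt n <= g%:R by rewrite /g /minn; case: ifP.
have kg : cbrt n <= g%:R :> R.
  by apply: le_trans gk; rewrite -[leLHS]mul1r ler_wpM2r// ltW.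
have g0 : 0 < g%:R :> R by lra.
have gh : g%:R <= cbrt n ^+ 2 / 2 :> R by apply: le_trans h1; rewrite ler_nat geq_minr.
rewrite LE ger0_norm ?drawn_sat_ge0//.
have gf : (g <= #|L n|)%N by rewrite cardL geq_minl.
apply: le_trans (drawn_fix_many (cbrtK n) k20 (cL n) gf kg gh) _.
rewrite mulrA ler_pdivrMr//; apply: le_trans (_ : d * (B * cbrt n) <= _).
  rewrite mulrA ler_wpM2r ?(ltW k0)//; move: Bd; rewrite ler_pdivrMr// mulrC; exact.
by rewrite ler_wpM2l// ltW.
Unshelve. all: by end_near. Qed.
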